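(* Let the system $\dot x=f(x)$ on $\mathbb{R}^n$, with $f$ twice continuously differentiable, have a stable hyperbolic fixed point $x^\ast$ with basin of attraction $\mathcal{B}(x^\ast)$. If the system is monotone on $\mathcal{B}(x^\ast)$ with dominant Koopman eigenfunction $s_1\in C^1(\mathcal{B}(x^\ast))$ (chosen increasing), then: (i) the set $\mathcal{B}_\alpha\subseteq\mathcal{B}(x^\ast)$ is order-convex and connected for any nonnegative $\alpha$ including $\alpha=\infty$; (ii) the boundary $\partial\mathcal{B}_\alpha$ of $\mathcal{B}_\alpha$ can be split into two manifolds: the set of minimal elements, equal to $\partial_-\mathcal{B}_\alpha$, and the set of maximal elements, equal to $\partial_+\mathcal{B}_\alpha$. Moreover, neither of the manifolds $\partial_-\mathcal{B}_\alpha$, $\partial_+\mathcal{B}_\alpha$ contains points $x,y$ such that $x\gg y$, for any nonnegative $\alpha$ including $\alpha=\infty$; (iii) if the system is strongly monotone on $\mathcal{B}(x^\ast)$, then neither of the manifolds $\partial_-\mathcal{B}_\alpha$, $\partial_+\mathcal{B}_\alpha$ contains points $x,y$ such that $x\succ y$, for any finite nonnegative $\alpha$.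
   Context: Order on $\mathbb{R}^n$: $x\succeq y$ iff $x-y\in\mathbb{R}^n_{\ge0}$; $x\succ y$ iff $x\succeq y$ and $x\ne y$; $x\gg y$ iff $x-y\in\mathbb{R}^n_{>0}$; $[x,y]=\{z:x\preceq z\preceq y\}$. A set $\mathcal{A}$ is order-convex if $[x,y]\subseteq\mathcal{A}$ for all $x,y\in\mathcal{A}$. For an order-convex set $\mathcal{A}$ with boundary $\partial\mathcal{A}$, the set of maximal elements consists of the $y\in\partial\mathcal{A}$ such that $y\ll z$ implies $z\notin\mathcal{A}$, and the set of minimal elements consists of the $y\in\partial\mathcal{A}$ such that $y\gg z$ implies $z\notin\mathcal{A}$. $\phi_f(t,x)$ is the flow of $\dot x=f(x)$. The basin of attraction is $\mathcal{B}=\mathcal{B}(x^\ast)=\{x\in\mathbb{R}^n:\lim_{t\to\infty}\phi_f(t,x)=x^\ast\}$. Stable hyperbolic means that all eigenvalues $\lambda_j$ of the Jacobian $J(x^\ast)$ satisfy $\Re(\lambda_j)<0$. Standing assumptions: $J(x^\ast)$ is diagonalizable and its distinct eigenvalues $\lambda_1,\dots,\lambda_k$ satisfy $\Re(\lambda_1)>\Re(\lambda_j)$ for all $j\ge2$. The system is monotone on $\mathcal{B}$ if $\phi_f(t,x)\preceq\phi_f(t,y)$ for all $t\ge0$ and all $x\preceq y$ in $\mathcal{B}$; it is strongly monotone on $\mathcal{B}$ if it is monotone and $\phi_f(t,x)\ll\phi_f(t,y)$ for all $t>0$ and all $x\prec y$ in $\mathcal{B}$. A dominant (Koopman) eigenfunction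 is a nontrivial $s_1\in C^1(\mathcal{B})$ with $s_1(\phi_f(t,x))=e^{\lambda_1t}s_1(x)$ for $x\in\mathcal{B}$, $t\ge 0$, equivalently $f(x)^T\nabla s_1(x)=\lambda_1s_1(x)$, normalized by $v_1^T\nabla s_1(x^\ast)=1$ where $v_1$ is a right eigenvector of $J(x^\ast)$ for $\lambda_1$. For monotone systems $\lambda_1$ is real and negative, and $s_1$ is chosen real and increasing: $s_1(x)\ge s_1(y)$ for all $x\succeq y$ in $\mathcal{B}$ (such a choice exists). For finite $\alpha\ge0$: $\mathcal{B}_\alpha=\{x\in\mathcal{B}:|s_1(x)|\le\alpha\}$, $\partial\mathcal{B}_\alpha=\{x\in\mathcal{B}:|s_1(x)|=\alpha\}$, $\partial_+\mathcal{B}_\alpha=\{x\in\mathcal{B}:s_1(x)=\alpha\}$, $\partial_-\mathcal{B}_\alpha=\{x\in\mathcal{B}:s_1(x)=-\alpha\}$. For $\alpha=\infty$: $\mathcal{B}_\infty=\mathcal{B}$, $\partial\mathcal{B}_\infty$ is the boundary of $\mathcal{B}$, and $\partial_\pm\mathcal{B}_\infty$ are the sets of maximal (for $+$) and minimal (for $-$) elements of $\mathcal{B}$.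
   Formalization: For α=∞ the sets of maximal and minimal elements need not be manifolds or disjoint (basin (-1,1)^2: closed arcs sharing end points); instead each, minus the points that are both maximal and minimal, is an (n-1)-dimensional topological manifold whose closure is the whole set. *)

(* Defs.v *)
From mathcomp Require Export all_boot all_order all_algebra.
From mathcomp Require Export complex.
From mathcomp Require Export all_classical all_reals all_analysis.
Export numFieldNormedType.Exports.

Set Implicit Arguments.
Unset Strict Implicit.
Unset Printing Implicit Defensive.

Import Order.TTheory GRing.Theory Num.Theory.

Local Open Scope classical_set_scope.
Local Open Scope ring_scope.

Section Order.
Context {R : realType} {n : nat}.
Implicit Types (x y z : 'rV[R]_n) (A bA : set 'rV[R]_n).

Definition vle x y := forall i, x ord0 i <= y ord0 i.
Definition vlt x y := vle x y /\ x <> y.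
Definition vll x y := forall i, x ord0 i < y ord0 i.

Definition order_interval x y : set 'rV[R]_n := [set z | vle x z /\ vle z y].

Definition order_convex A :=
  forall x y, A x -> A y -> order_interval x y `<=` A.

Definition frontier A : set 'rV[R]_n := closure A `\` interior A.

(* The boundary [bA] of [A] is an argument: it is [frontier A] for a basin of
   attraction, but a level set inside the basin for a sublevel set of the
   eigenfunction, which may be smaller than the topological frontier. *)
Definition maximal_elements A bA : set 'rV[R]_n :=
  [set y | bA y /\ forall z, vll y z -> ~ A z].
Definition minimal_elements A bA : set 'rV[R]_n :=
  [set y | bA y /\ forall z, vll z y -> ~ A z].

End Order.

Section Manifold.
Context {R : realType} {n : nat}.

(* Topological manifold (without boundary) of dimension [d], for the topology
   induced by R^n: every point has a relatively open neighbourhood that is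
   homeomorphic to an open subset of R^d. *)
Definition manifold (d : nat) (A : set 'rV[R]_n) :=
  forall x, A x ->
    exists (U : set 'rV[R]_n) (g : 'rV[R]_n -> 'rV[R]_d)
           (h : 'rV[R]_d -> 'rV[R]_n),
      [/\ open U /\ U x,
          open (g @` (A `&` U)),
          {within A `&` U, continuous g},
          {within g @` (A `&` U), continuous h} &
          forall y, (A `&` U) y -> h (g y) = y].

(* [A] is a manifold off its edge [E], and is the closure of that manifold.
   An edge cannot be avoided for the maximal elements of a basin: those of
   (-1,1)^2 form an arc whose end points (-1,1) and (1,-1) are also minimal.
   Nothing is said of the shape of [A] at the points of [E], since in dimension
   at least 3 it need not be a manifold with boundary there. *)
Definition manifold_with_edge (d : nat) (A E : set 'rV[R]_n) :=
  manifold d (A `\` E) /\ closure (A `\` E) = A.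

End Manifold.

(* Meaningful for [A] open, because differentiability at a point of [A] refers
   to a full neighbourhood of it. *)
Definition C1_on {R : realType} {V W : normedModType R} (A : set V)
    (g : V -> W) :=
  forall x, A x ->
    differentiable g x /\
    forall v, {for x, continuous (fun y => 'd g y v : W)}.

Section Dynamics.
Context {R : realType} {n : nat}.
Variable f : 'rV[R]_n -> 'rV[R]_n.
Implicit Types (x y xs v : 'rV[R]_n) (u : R -> 'rV[R]_n) (l t : R).

Definition twice_continuously_differentiable :=
  C1_on setT f /\ C1_on setT (fun x => 'J f x).

(* The values [u t] for [t < 0] are irrelevant; as every forward solution can be
   extended differentiably to [t < 0], the two-sided derivative at 0 is no
   restriction. *)
Definition forward_solution x u :=
  u 0 = x /\ forall t, 0 <= t -> is_derive t (1 : R) u (f (u t)).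

(* [flow t x] for [t >= 0]; it is only meaningful when the solution starting
   at [x] exists for all [t >= 0], which is the case on a basin of attraction. *)
Definition flow t x : 'rV[R]_n :=
  (xget (fun=> x) [set u | forward_solution x u]) t.

Definition basin xs : set 'rV[R]_n :=
  [set x | (exists u, forward_solution x u) /\ flow t x @[t --> +oo] --> xs].

Definition monotone_on (B : set 'rV[R]_n) :=
  forall x y, B x -> B y -> vle x y ->
  forall t, 0 <= t -> vle (flow t x) (flow t y).

Definition strongly_monotone_on (B : set 'rV[R]_n) :=
  monotone_on B /\
  forall x y, B x -> B y -> vlt x y ->
  forall t, 0 < t -> vll (flow t x) (flow t y).

(* ['J f xs] acts on row vectors by [v *m 'J f xs = 'd f xs v]: it is the
   transpose of the usual Jacobian matrix, so that the left eigenvectors of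
   ['J f xs] are the right eigenvectors of the latter. *)
Definition complex_jacobian xs : 'M[R[i]]_n :=
  map_mx (real_complex R) ('J f xs).

Definition stable_hyperbolic xs :=
  f xs = 0 /\
  forall mu : R[i], eigenvalue (complex_jacobian xs) mu -> complex.Re mu < 0.

Definition dominant_eigenvalue xs l :=
  eigenvalue (complex_jacobian xs) (real_complex R l) /\
  forall mu : R[i], eigenvalue (complex_jacobian xs) mu ->
    mu != real_complex R l -> complex.Re mu < l.

Definition right_eigenvector xs l v :=
  v != 0 /\ v *m 'J f xs = l *: v.

Definition dominant_eigenfunction xs l v (s : 'rV[R]_n -> R) :=
  [/\ C1_on (basin xs) s,
      exists2 x, basin xs x & s x != 0,
      forall x t, basin xs x -> 0 <= t -> s (flow t x) = expR (l * t) * s x &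
      'd s xs v = 1].

Definition increasing_on (B : set 'rV[R]_n) (s : 'rV[R]_n -> R) :=
  forall x y, B x -> B y -> vle y x -> s y <= s x.

End Dynamics.

Section Isostables.
Context {R : realType} {n : nat}.
Variables (B : set 'rV[R]_n) (s : 'rV[R]_n -> R) (alpha : \bar R).

(* Only [0 <= alpha] is meaningful: the default branches stand for [+oo]. *)
Definition sublevel : set 'rV[R]_n :=
  [set x | B x /\ (`|s x|%:E <= alpha)%E].

Definition sublevel_bd : set 'rV[R]_n :=
  if alpha is r%:E then [set x | B x /\ `|s x| = r] else frontier B.

Definition sublevel_bd_plus : set 'rV[R]_n :=
  if alpha is r%:E then [set x | B x /\ s x = r]
  else maximal_elements B (frontier B).

Definition sublevel_bd_minus : set 'rV[R]_n :=
  if alpha is r%:E then [set x | B x /\ s x = - r]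
  else minimal_elements B (frontier B).

End Isostables.

(* Main.v *)
Require Import Defs.
From mathcomp Require Import ring lra.

(** Let [y <= z <= x] with [y] and [x] in the basin.  Trajectories that start in
    the basin on the segment from [y] to [z] stay between those of [y] and [x], so that continuous dependence
    holds along them with a uniform modulus; as the basin is open, finitely many
    small steps lead from [y] to [z] inside it, which is therefore order-convex.

    If the increasing eigenfunction took equal values at [y << x], it would be
    constant near some point [m].  The flow maps neighbourhoods of [m] onto
    neighbourhoods of its later positions, so the differential of the
    eigenfunction vanishes along the trajectory of [m], and in the limit at the
    fixed point, against the normalization.  Hence the eigenfunction is strictly
    increasing for [<<].

    Sets without two points related by [<<] which meet every line of direction
    [(1,...,1)] close to one of their points are Lipschitz graphs over the
    quotient by that direction.  This applies to the level sets by the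
    intermediate value theorem, and to the minimal elements of the basin that
    are not maximal by following such a line until it leaves the basin. *)

Set Implicit Arguments.
Unset Strict Implicit.
Unset Printing Implicit Defensive.

Import Order.TTheory GRing.Theory Num.Theory.

Local Open Scope classical_set_scope.
Local Open Scope ring_scope.

(** * Calculus along a real parameter *)

Section RowVectors.
Context {R : realType} {n : nat}.
Implicit Types (x y : 'rV[R]_n) (c : R).

Lemma normr_coord x i : `|x ord0 i| <= `|x|.
Proof.
rewrite [leRHS]/Num.Def.normr/= mx_normrE.
exact: (le_bigmax _ (fun ij : 'I_1 * 'I_n => `|x ij.1 ij.2|) (ord0, i)).
Qed.

Lemma normr_rV_le x c : 0 <= c -> (forall i, `|x ord0 i| <= c) -> `|x| <= c.
Proof.
move=> c0 xc; rewrite [leLHS]/Num.Def.normr/= mx_normrE.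
by apply: bigmax_le => //= -[i j] _; rewrite ord1.
Qed.

Lemma normr_rV_lt x c : 0 < c -> (forall i, `|x ord0 i| < c) -> `|x| < c.
Proof.
move=> c0 xc; rewrite [ltLHS]/Num.Def.normr/= mx_normrE.
by apply: bigmax_lt => //= -[i j] _; rewrite ord1.
Qed.

(** The norm on row vectors is the sup norm, which is not differentiable. Differential inequalities
    are run on the sum of squares instead; this lemma and the next translate between the two. *)
Lemma sqr_normr_rV_le x : `|x| ^+ 2 <= \sum_i x ord0 i ^+ 2.
Proof.
have s0 : 0 <= \sum_i x ord0 i ^+ 2 by apply: sumr_ge0 => i _; exact: sqr_ge0.
rewrite -[leRHS]sqr_sqrtr// ler_sqr ?nnegrE ?sqrtr_ge0//.
apply: normr_rV_le => [|i]; first exact: sqrtr_ge0.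
rewrite -sqrtr_sqr; apply: ler_wsqrtr; rewrite (bigD1 i)//= lerDl.
by apply: sumr_ge0 => j _; exact: sqr_ge0.
Qed.

Lemma sum_sqr_rV_le x : \sum_i x ord0 i ^+ 2 <= n%:R * `|x| ^+ 2.
Proof.
have -> : n%:R * `|x| ^+ 2 = \sum_(i < n) `|x| ^+ 2.
  by rewrite sumr_const card_ord mulr_natl.
apply: ler_sum => i _.
by rewrite -[_ ^+ 2]real_normK ?num_real// ler_sqr ?nnegrE//; exact: normr_coord.
Qed.

Lemma continuous_coord {T : topologicalType} (w : T -> 'rV[R]_n) i t :
  {for t, continuous w} -> {for t, continuous (fun t => w t ord0 i)}.
Proof.
move=> cw; have H := @coord_continuous R 1 n ord0 i (w t).
exact: (@cvg_comp _ _ _ w (fun M : 'rV[R]_n => M ord0 i) _ _ _ cw H).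
Qed.

Lemma is_derive_rV (u : R -> 'rV[R]_n) (t : R) v :
  is_derive t 1 u v <->
  forall i, is_derive t (1 : R) (fun t => u t ord0 i) (v ord0 i).
Proof.
split=> [[du uv] i|H].
  apply: DeriveDef; first exact: (derivable_mxP _ _ _).1.
  by rewrite -uv derive_mx// mxE.
have du : derivable u t 1.
  by apply/derivable_mxP => i j; rewrite ord1; apply: ex_derive.
apply: DeriveDef => //; rewrite derive_mx//.
by apply/rowP => i; rewrite mxE; apply: derive_val.
Qed.

End RowVectors.

Section Calculus.
Context {R : realType}.

Lemma lipschitz_continuous {V W : normedModType R} (g : V -> W) (L : R) :
  (forall y z, `|g y - g z| <= L * `|y - z|) -> continuous g.
Proof.
move=> gL y; apply/cvgrPdist_lt => e e0.
have L0 : 0 < Num.max L 1 by rewrite lt_max ltr01 orbT.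
have /(@cvgrPdist_lt _ _ _ (nbhs y)) near_y : z @[z --> y] --> y.
  exact: cvg_id.
near=> z; apply: le_lt_trans (gL _ _) _.
apply: (@le_lt_trans _ _ (Num.max L 1 * `|y - z|)).
  by rewrite ler_wpM2r// le_max lexx.
rewrite -ltr_pdivlMl//; near: z; apply: near_y.
by rewrite mulr_gt0// invr_gt0.
Unshelve. all: by end_near. Qed.

Lemma is_derive_continuous {V : normedModType R} (u : R -> V) t v :
  is_derive t (1 : R) u v -> {for t, continuous u}.
Proof.
by case=> du _; apply/differentiable_continuous/derivable1_diffP.
Qed.

Lemma is_derive_ge0_le (h dh : R -> R) (a b : R) : a <= b ->
  (forall t, a <= t <= b -> is_derive t (1 : R) h (dh t)) ->
  (forall t, a <= t <= b -> 0 <= dh t) -> h a <= h b.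
Proof.
move=> ab hd dh0; rewrite -subr_ge0.
have [||c /[!in_itv]/= cab ->] := @MVT_segment _ h dh a b ab.
- by move=> x /[!in_itv]/= /andP[ax xb]; apply: hd; rewrite !ltW.
- apply: continuous_in_subspaceT => x /[!inE]/= /[!in_itv]/= xab.
  exact: is_derive_continuous (hd _ xab).
- by rewrite mulr_ge0 ?dh0// subr_ge0.
Qed.

Lemma is_derive_bound_le (p q dp dq : R -> R) (t : R) : 0 <= t ->
  (forall s, 0 <= s <= t -> is_derive s (1 : R) p (dp s)) ->
  (forall s, 0 <= s <= t -> is_derive s (1 : R) q (dq s)) ->
  (forall s, 0 <= s <= t -> `|dp s| <= dq s) ->
  `|p t - p 0| <= q t - q 0.
Proof.
move=> t0 pd qd pq; rewrite ler_norml; apply/andP; split.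
  have : (q + p) 0 <= (q + p) t.
    apply: (@is_derive_ge0_le _ (fun s => dq s + dp s)) => // s st.
      by apply: is_deriveD; [exact: qd|exact: pd].
    by have := pq s st; rewrite ler_norml; lra.
  by rewrite !fctE; lra.
have : (q - p) 0 <= (q - p) t.
  apply: (@is_derive_ge0_le _ (fun s => dq s - dp s)) => // s st.
    by apply: is_deriveB; [exact: qd|exact: pd].
  by have := pq s st; rewrite ler_norml; lra.
by rewrite !fctE; lra.
Qed.

Lemma is_derive_expRM (c t : R) :
  is_derive t (1 : R) (fun s => expR (c * s)) (c * expR (c * t)).
Proof.
have H : is_derive t (1 : R) (fun s : R => c * s) c.
  by apply: is_derive_eq; rewrite [_ *: 1]mulr1 //.
rewrite mulrC; exact: (@is_derive1_comp _ (@expR R) (fun s => c * s) t).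
Qed.

Lemma is_derive_ZexpRM (a c t : R) :
  is_derive t (1 : R) (fun s => a * expR (c * s)) (a * (c * expR (c * t))).
Proof. by have H := is_derive_expRM c t; exact: is_deriveZ. Qed.

Lemma is_derive_affine (a b t : R) :
  is_derive t (1 : R) (fun s => a + s * b) b.
Proof.
by apply: is_derive_eq; rewrite add0r mul1r scaler0 add0r [_%:A]mulr1.
Qed.

Lemma is_derive_sqr (h : R -> R) (t dh : R) : is_derive t (1 : R) h dh ->
  is_derive t (1 : R) (fun s => h s ^+ 2) ((h t * dh) *+ 2).
Proof.
move=> H; have -> : (fun s => h s ^+ 2) = h * h.
  by apply/funext => s; rewrite expr2.
exact: is_deriveM.
Qed.

(** The product of [q t] with the integrating factor [expR (- c * t)] has a nonpositive derivative.
    The sign of [c] is free: it is nonnegative for continuous dependence, negative for the decay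
    near the fixed point. *)
Lemma gronwall (q dq : R -> R) (c T : R) : 0 <= T ->
  (forall t, 0 <= t <= T -> is_derive t (1 : R) q (dq t)) ->
  (forall t, 0 <= t <= T -> dq t <= c * q t) ->
  q T <= expR (c * T) * q 0.
Proof.
move=> T0 qd dqc.
pose h t := - (expR (- c * t) * q t).
pose dh t := - (expR (- c * t) * dq t + q t * (- c * expR (- c * t))).
have : h 0 <= h T.
  apply: (@is_derive_ge0_le _ dh) => // t tT.
    apply: is_deriveN.
    by apply: (@is_deriveM _ _ _ q _ _ _ _ (is_derive_expRM _ _) (qd t tT)).
  rewrite /dh.
  have := dqc t tT; have := expR_gt0 (- c * t).
  move: (expR (- c * t)) (dq t) (q t) => e d w e0 dw.
  have -> : - (e * d + w * (- c * e)) = e * (c * w - d) by ring.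
  by rewrite mulr_ge0 ?subr_ge0// ltW.
rewrite /h mulr0 expR0 mul1r lerN2 => H.
rewrite -(ler_pM2l (expR_gt0 (- c * T))) mulrA -expRD mulNr addNr expR0 mul1r.
by rewrite -mulNr.
Qed.

End Calculus.

(** * Existence of solutions *)

Section Picard.
Context {R : realType} {n : nat}.

Lemma is_derive_dist_le (P Q dP dQ : R -> 'rV[R]_n) (q dq : R -> R) (t : R) :
  0 <= t -> P 0 = Q 0 ->
  (forall s, 0 <= s <= t -> is_derive s (1 : R) P (dP s)) ->
  (forall s, 0 <= s <= t -> is_derive s (1 : R) Q (dQ s)) ->
  (forall s, 0 <= s <= t -> is_derive s (1 : R) q (dq s)) ->
  (forall s, 0 <= s <= t -> `|dP s - dQ s| <= dq s) ->
  `|P t - Q t| <= q t - q 0.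
Proof.
move=> t0 PQ0 Pd Qd qd dPQ.
have dq0 s : 0 <= s <= t -> 0 <= dq s by move=> /dPQ; apply: le_trans.
apply: normr_rV_le => [|i].
  by rewrite subr_ge0; apply: is_derive_ge0_le qd dq0.
have PQi0 : P 0 ord0 i - Q 0 ord0 i = 0 by rewrite PQ0 subrr.
have := @is_derive_bound_le _ (fun s => P s ord0 i - Q s ord0 i) q
  (fun s => dP s ord0 i - dQ s ord0 i) dq t t0.
rewrite PQi0 subr0 !mxE; apply => // s st.
  by apply: is_deriveB; [exact: (is_derive_rV _ _ _).1 (Pd s st) i
                        |exact: (is_derive_rV _ _ _).1 (Qd s st) i].
by have := normr_coord (dP s - dQ s) i; rewrite !mxE => /le_trans -> //; exact: dPQ.
Qed.

Lemma antiderivative (w : R -> R) : continuous w ->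
  exists W : R -> R, forall t : R, 0 <= t -> is_derive t (1 : R) W (w t).
Proof.
(* Integrating from -1 makes every [t >= 0] an interior point, so that the derivative at 0 is
   two-sided. *)
move=> cw; exists (fun t => \int[lebesgue_measure]_(s in `[-1, t]) w s)%R => t t0.
have tt : t < t + 1 by rewrite ltrDl.
have [||dW Wt] := @continuous_FTC1_closed R w (-1) t (t + 1) tt _ _ (cw t).
- apply: continuous_compact_integrable; first exact: segment_compact.
  exact: continuous_subspaceT.
- by rewrite (lt_le_trans _ t0)// ltrN10.
by apply: DeriveDef; [exact: dW|rewrite -derive1E; exact: Wt].
Qed.

Lemma antiderivative_rV (w : R -> 'rV[R]_n) (x : 'rV[R]_n) : continuous w ->
  exists2 W : R -> 'rV[R]_n, W 0 = x &
    forall t : R, 0 <= t -> is_derive t (1 : R) W (w t).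
Proof.
move=> cw.
have /choice[W HW] : forall i, exists W : R -> R,
    forall t : R, 0 <= t -> is_derive t (1 : R) W (w t ord0 i).
  by move=> i; apply: antiderivative => t; apply: continuous_coord; exact: cw.
exists (fun t => x + \row_i (W i t - W i 0)).
  by apply/rowP => i; rewrite !mxE subrr addr0.
move=> t t0; apply/is_derive_rV => i.
rewrite (_ : (fun _ => _) = (fun t => W i t + (x ord0 i - W i 0))); last first.
  by apply/funext => s; rewrite !mxE; ring.
have := HW i t t0 => H.
apply: (@is_derive_eq _ _ _ _ _ _ _ (w t ord0 i + 0)); last by rewrite addr0.
Qed.

(** The increments from [k] to [k + m] add up to at most a partial geometric sum, whose value is
    [2 * a * (2 ^- k - 2 ^- (k + m))]; completeness provides the limit. *)
Lemma geometric_cauchy (v : nat -> 'rV[R]_n) (a : R) :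
  (forall k, `|v k.+1 - v k| <= a * 2 ^- k) ->
  exists l, forall k, `|l - v k| <= 2 * a * 2 ^- k.
Proof.
move=> va.
have a0 : 0 <= a by have := va 0%N; rewrite expr0 invr1 mulr1; apply: le_trans.
have far k m : `|v (k + m)%N - v k| <= 2 * a * (2 ^- k - 2 ^- (k + m)).
  elim: m => [|m IH].
    by rewrite addn0 !subrr normr0 mulr0.
  rewrite addnS -(subrKA (v (k + m)%N) (v _) (- v k)).
  apply: le_trans (ler_normD _ _) _; apply: le_trans (lerD (va _) IH) _.
  rewrite exprS invfM; move: (2 ^- (k + m)) (2 ^- k) => p q.
  suff -> : a * p + 2 * a * (q - p) = 2 * a * (q - 2^-1 * p) by [].
  by field.
have far' k m : (k <= m)%N -> `|v m - v k| <= 2 * a * 2 ^- k.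
  move=> km; have := far k (m - k)%N; rewrite subnKC// => /le_trans; apply.
  rewrite ler_wpM2l// ?mulr_ge0// gerBl invr_ge0.
  exact: exprn_ge0.
have cv : cvgn v.
  apply/cauchy_cvgP/cauchy_exP => e e0.
  have /cvgrPdist_lt/(_ _ e0)[N _ /(_ N (leqnn N)) HN] :
      (2 * a) * 2^-1 ^+ k @[k --> \oo] --> 0.
    rewrite -[X in _ --> X](mulr0 (2 * a)); apply: cvgMr; apply: cvg_expr.
    by rewrite ger0_norm ?invf_lt1 ?ltr1n.
  exists (v N); exists N => // k /= Nk; rewrite -ball_normE /ball_/= distrC.
  apply: le_lt_trans (far' _ _ Nk) _.
  by move: HN; rewrite /= sub0r normrN exprVn ger0_norm// !mulr_ge0// invr_ge0 exprn_ge0.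
exists (lim (v @ \oo)) => k.
have /cvg_norm H : v m - v k @[m --> \oo] --> lim (v @ \oo) - v k.
  by apply: cvgB => //; exact: cvg_cst.
by apply: (cvgr_to_le H); exists k => // m /= /far'.
Qed.

(** As [a] is monotone, the convergence is uniform up to time [t + 1], which suffices for continuity
    at [t] by the usual three-term estimate. *)
Lemma uniform_limit_continuous (u : R -> 'rV[R]_n) (v : nat -> R -> 'rV[R]_n)
    (a : R -> R) :
  (forall k, continuous (v k)) -> {homo a : s t / s <= t} ->
  (forall k t, `|u t - v k t| <= a t * 2 ^- k) -> continuous u.
Proof.
move=> cv a_mono uv t; apply/cvgrPdist_lt => e e0.
have a0 : 0 <= a (t + 1).
  by have := uv 0%N (t + 1); rewrite expr0 invr1 mulr1; apply: le_trans.
have [k ak] : exists k, a (t + 1) * 2 ^- k < e / 4.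
  have : a (t + 1) * 2^-1 ^+ k @[k --> \oo] --> 0.
    rewrite -[X in _ --> X](mulr0 (a (t + 1))); apply: cvgMr; apply: cvg_expr.
    by rewrite ger0_norm ?invf_lt1 ?ltr1n.
  move=> /cvgrPdist_lt/(_ (e / 4)) [|N _ /(_ N (leqnn N))]; first by lra.
  rewrite /= sub0r normrN exprVn ger0_norm ?mulr_ge0 ?invr_ge0 ?exprn_ge0//.
  by exists N.
have le_uv s : s <= t + 1 -> `|u s - v k s| <= e / 4.
  move=> st; apply: le_trans (uv k s) _; apply: le_trans (ltW ak).
  by rewrite ler_wpM2r ?a_mono// invr_ge0 exprn_ge0.
have /cvgrPdist_lt/(_ (e / 4)) cvt : v k s @[s --> t] --> v k t by exact: cv.
near=> s.
have H1 : `|u t - v k t| <= e / 4 by apply: le_uv; rewrite lerDl.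
have H2 : `|v k t - v k s| < e / 4 by near: s; apply: cvt; lra.
have H3 : `|u s - v k s| <= e / 4.
  by apply: le_uv; near: s; apply: (cvgr_le _ (@cvg_id _ _)); rewrite ltrDl.
rewrite -(subrKA (v k t) (u t) (- u s)) -(subrKA (v k s) (v k t) (- u s)).
have := ler_normD (u t - v k t) (v k t - v k s + (v k s - u s)).
have := ler_normD (v k t - v k s) (v k s - u s).
rewrite (distrC (v k s)); lra.
Unshelve. all: by end_near. Qed.

(** Picard iteration for all [t >= 0] at once. Distances are weighted by [expR (2 * L * t)]:
    integrating [L * expR (2 * L * s)] gives back at most half of the weight, so each iteration
    halves the weighted distance. *)
Lemma lipschitz_forward_solution (g : 'rV[R]_n -> 'rV[R]_n) (L : R) x :
  (forall y z, `|g y - g z| <= L * `|y - z|) ->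
  exists u, forward_solution g x u.
Proof.
wlog L0 : L / 0 < L => [wlg gL|].
  apply: (wlg (Num.max L 1)) => [|y z]; first by rewrite lt_max ltr01 orbT.
  by rewrite (le_trans (gL y z))// ler_wpM2r// le_max lexx.
move=> gL.
have cg : continuous g := lipschitz_continuous gL.
(* Antiderivatives are controlled at nonnegative times only; precomposing the iterates with [pos]
   keeps them continuous on the whole line. *)
pose pos (t : R) := Num.max t 0.
have pos_ge0 t : 0 <= pos t by rewrite le_max lexx orbT.
have posE t : 0 <= t -> pos t = t by move=> t0; apply/max_idPl.
have cpos : continuous pos.
  by move=> t; apply: continuous_max; [exact: cvg_id|exact: cvg_cst].
have /choice[A HA] : forall v : R -> 'rV[R]_n, exists W : R -> 'rV[R]_n,
    continuous v ->
    W 0 = x /\ forall t : R, 0 <= t -> is_derive t (1 : R) W (g (v t)).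
  move=> v; have [cv|] := pselect (continuous v); last by exists v.
  have [|W W0 HW] := @antiderivative_rV (g \o v) x; last by exists W.
  by move=> t; apply: continuous_comp; [exact: cv|exact: cg].
pose V k := iter k (fun v => A v \o pos) (fun=> x).
have cV k : continuous (V k).
  elim: k => [|k IH]; first by move=> t; exact: cvg_cst.
  move=> t; apply: continuous_comp; first exact: cpos.
  exact: is_derive_continuous ((HA _ IH).2 _ (pos_ge0 t)).
have seg (s t : R) : 0 <= s <= t -> 0 <= s by case/andP.
(* As [C * (2 * L) = |g x|], the derivative of [C * expR (2 * L * s)] dominates the speed of the
   first iterate. *)
pose C := `|g x| / (2 * L).
have C0 : 0 <= C by rewrite divr_ge0// mulr_ge0// ltW.
have pow0 k : 0 <= 2 ^- k :> R by rewrite invr_ge0 exprn_ge0.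
have VD t k : 0 <= t -> `|V k.+1 t - V k t| <= C * expR (2 * L * t) * 2 ^- k.
  elim: k t => [|k IH] t t0.
    rewrite expr0 invr1 mulr1 /V /= posE//.
    have [A0 dA] := HA _ (cV 0%N).
    have := @is_derive_dist_le _ (cst x) (fun s => g x) (fun=> 0)
      (fun s => C * expR (2 * L * s)) _ t t0 A0
      (fun s st => dA s (seg _ _ st)) (fun s _ => is_derive_cst x s 1)
      (fun s _ => is_derive_ZexpRM C (2 * L) s).
    rewrite mulr0 expR0 mulr1 => H; apply: le_trans (H _) _.
      + move=> s /andP[s0 _]; rewrite subr0 /C mulrA divfK ?gt_eqF ?mulr_gt0//.
      by rewrite ler_peMr// -expR0 ler_expR !mulr_ge0// ltW.
    + by rewrite gerBl.
  have [A0 dA] := HA _ (cV k.+1); have [B0 dB] := HA _ (cV k).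
  have := @is_derive_dist_le _ _ _ _
    (fun s => C * 2 ^- k.+1 * expR (2 * L * s)) _ t t0 (etrans A0 (esym B0))
    (fun s st => dA s (seg _ _ st)) (fun s st => dB s (seg _ _ st))
    (fun s _ => is_derive_ZexpRM (C * 2 ^- k.+1) (2 * L) s).
  rewrite mulr0 expR0 mulr1 [V k.+2]iterS [in V k.+1 t]/V iterS /= posE// => H.
  apply: le_trans (H _) _.
  + move=> s /andP[s0 _]; apply: le_trans (gL _ _) _.
    apply: le_trans (ler_wpM2l (ltW L0) (IH s s0)) _.
    rewrite exprS invfM; move: (2 ^- k) (expR _) => p q.
    by rewrite le_eqVlt; apply/orP; left; apply/eqP; field.
  + have := pow0 k; have := mulr_ge0 C0 (pow0 k.+1); have := expR_gt0 (2 * L * t).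
    rewrite exprS invfM; move: (2 ^- k) (expR _) => p q; nra.
have VposE k t : V k (pos t) = V k t.
  by case: k => [//|k]; rewrite /V iterS /= [pos (pos t)]posE.
have /choice[u uV] : forall t, exists l, forall k,
    `|l - V k t| <= 2 * (C * expR (2 * L * pos t)) * 2 ^- k.
  move=> t; apply: geometric_cauchy => k.
  by rewrite -VposE -(VposE k); exact: VD.
have cu : continuous u.
  apply: (uniform_limit_continuous cV (a := fun t => 2 * (C * expR (2 * L * pos t)))).
    move=> s t st; rewrite !ler_wpM2l// ler_expR ler_wpM2l ?mulr_ge0 ?(ltW L0)//.
    by rewrite /pos ge_max !le_max st lexx orbT.
  by move=> k t; exact: uV.
have [W0 dW] := HA _ cu.
have WV t k : 0 <= t -> `|A u t - V k.+1 t| <= C * expR (2 * L * t) * 2 ^- k.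
  move=> t0; have [B0 dB] := HA _ (cV k).
  have := @is_derive_dist_le _ _ _ _
    (fun s => C * 2 ^- k * expR (2 * L * s)) _ t t0 (etrans W0 (esym B0))
    (fun s st => dW s (seg _ _ st)) (fun s st => dB s (seg _ _ st))
    (fun s _ => is_derive_ZexpRM (C * 2 ^- k) (2 * L) s).
  rewrite mulr0 expR0 mulr1 /V iterS /= posE// => H.
  apply: le_trans (H _) _.
  + move=> s /andP[s0 _]; apply: le_trans (gL _ _) _.
    apply: le_trans (ler_wpM2l (ltW L0) (uV s k)) _; rewrite posE//.
    move: (2 ^- k) (expR _) => p q.
    by rewrite le_eqVlt; apply/orP; left; apply/eqP; ring.
  + by rewrite mulrAC gerBl; exact: mulr_ge0.
(* The iterates converge both to [u] and to the antiderivative [A u]. *)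
have uW t : 0 <= t -> A u t = u t.
  move=> t0; apply/eqP; rewrite -subr_eq0 -normr_le0.
  have H : C * expR (2 * L * t) * 2 * 2^-1 ^+ k @[k --> \oo] --> 0.
    rewrite -[X in _ --> X](mulr0 (C * expR (2 * L * t) * 2)).
    by apply: cvgMr; apply: cvg_expr; rewrite ger0_norm ?invf_lt1 ?ltr1n.
  apply: (cvgr_to_ge H); near=> k.
  rewrite -(subrKA (V k.+1 t)); apply: le_trans (ler_normD _ _) _.
  rewrite (distrC (V _ _)); apply: le_trans (lerD (WV _ _ t0) (uV _ _)) _.
  rewrite posE// exprVn exprS invfM; move: (2 ^- k) (expR _) => p q.
  by rewrite le_eqVlt; apply/orP; left; apply/eqP; field.
by exists (A u); split => // t t0; rewrite uW//; exact: dW.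
Unshelve. all: by end_near. Qed.

End Picard.

(** * Truncation and continuous dependence *)

Section Clamp.
Context {R : realType}.

Definition clamp1 (r a : R) : R := Num.max (- r) (Num.min r a).

Lemma clamp1_dist r a b : `|clamp1 r a - clamp1 r b| <= `|a - b|.
Proof.
have := lexx `|a - b|; rewrite {1}ler_norml => /andP[].
move: `|a - b| (normr_ge0 (a - b)) => e e0 H1 H2.
rewrite /clamp1 !maxEle !minEle ler_norml.
by do 4! case: ifP; lra.
Qed.

Lemma clamp1_id r a : `|a| <= r -> clamp1 r a = a.
Proof.
rewrite ler_norml /clamp1 => /andP[ra ar].
by rewrite (min_idPr ar) (max_idPr ra).
Qed.

Lemma clamp1_norm_le r a : 0 <= r -> `|clamp1 r a| <= r.
Proof.
move=> r0; rewrite /clamp1 maxEle minEle ler_norml.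
by do 2! case: ifP; lra.
Qed.

Context {n : nat}.
Implicit Types (c x y : 'rV[R]_n) (r : R).

(** For [0 <= r], a 1-Lipschitz retraction onto the closed ball about [c]. Composing with it turns a
    field that is Lipschitz on the ball into a globally Lipschitz one with the same values there. *)
Definition clamp c r x : 'rV[R]_n := c + \row_i clamp1 r ((x - c) ord0 i).

Lemma clamp_dist c r x y : `|clamp c r x - clamp c r y| <= `|x - y|.
Proof.
apply: normr_rV_le => // i.
rewrite /clamp opprD addrACA subrr add0r !mxE.
apply: le_trans (clamp1_dist _ _ _) _.
by have := normr_coord (x - y) i; rewrite !mxE opprB addrA subrK.
Qed.

Lemma clamp_id c r x : `|x - c| <= r -> clamp c r x = x.
Proof.
move=> xc; apply/rowP => i; rewrite !mxE clamp1_id; first by rewrite subrKC.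
by have := normr_coord (x - c) i; rewrite !mxE => /le_trans; apply.
Qed.

Lemma clamp_ball c r x : 0 <= r -> `|clamp c r x - c| <= r.
Proof.
move=> r0; apply: normr_rV_le => // i.
by rewrite /clamp addrC addKr mxE clamp1_norm_le.
Qed.

Lemma clamp_center c r x : 0 <= r -> `|clamp c r x - c| <= `|x - c|.
Proof.
move=> r0; have := clamp_dist c r x c.
by rewrite [clamp c r c]clamp_id// subrr normr0.
Qed.

End Clamp.

Section C1Lipschitz.
Context {R : realType}.

Lemma is_derive_comp_diff {V W : normedModType R} (f : V -> W) (u : R -> V)
    (t : R) v :
  is_derive t (1 : R) u v -> differentiable f (u t) ->
  is_derive t (1 : R) (f \o u) ('d f (u t) v).
Proof.
case=> /derivable1_diffP du uv df.
have dfu : differentiable (f \o u) t by exact: differentiable_comp.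
apply: DeriveDef; first exact/derivable1_diffP.
by rewrite deriveE// diff_comp//= -uv deriveE.
Qed.

Lemma C1_on_opp {V W : normedModType R} (g : V -> W) :
  C1_on setT g -> C1_on setT (- g).
Proof.
move=> gC1 x _; have [dg cdg] := gC1 x I; split; first exact: differentiableN.
move=> w; have -> : (fun y => 'd (- g) y w : W) = (fun y => - ('d g y w : W)).
  apply/funext => y.
  by have H := diffN (gC1 y I).1; rewrite H.
exact: continuousN (cdg w).
Qed.

Lemma closed_ball_compact n (c : 'rV[R]_n) (r : R) : compact [set z | `|z - c| <= r].
Proof.
apply: bounded_closed_compact.
  exists (r + `|c|); split; first exact: num_real.
  move=> M rM z /= zr; apply: le_trans (ltW rM).
  by rewrite -[z in leLHS](subrK c) (le_trans (ler_normD _ _))// lerD2r.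
have cn : continuous (fun z : 'rV[R]_n => `|z - c|).
  apply: (@lipschitz_continuous _ _ _ _ 1) => y z; rewrite mul1r.
  by apply: le_trans (ler_dist_dist _ _) _; rewrite opprB addrA subrK.
exact: (continuous_closedP _).1 cn _ (@closed_le R r).
Qed.

(** The partial derivatives are continuous, hence bounded on the compact ball. By convexity the
    segment between two of its points stays in it, and the mean value inequality applies along
    it. *)
Lemma C1_lipschitz_ball n (f : 'rV[R]_n -> 'rV[R]_n) c r : C1_on setT f ->
  exists2 L, 0 <= L & forall x y, `|x - c| <= r -> `|y - c| <= r ->
    `|f x - f y| <= L * `|x - y|.
Proof.
move=> fC1.
have /choice[M HM] : forall j : 'I_n, exists M, forall z, `|z - c| <= r ->
    `|'d f z ('e_j : 'rV[R]_n)| <= M.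
  move=> j.
  have cd : continuous (fun z => 'd f z ('e_j : 'rV[R]_n)).
    by move=> z; exact: (fC1 z I).2.
  have : compact ((fun z => 'd f z ('e_j : 'rV[R]_n)) @` [set z | `|z - c| <= r]).
    apply: continuous_compact; last exact: closed_ball_compact.
    exact: continuous_subspaceT.
  move=> /compact_bounded[M [_ HM]]; exists (M + 1) => z zr.
  by apply: (HM (M + 1)); [rewrite ltrDl|exists z].
have dM z v : `|z - c| <= r -> `|'d f z v| <= (\sum_j `|M j|) * `|v|.
  move=> zr; rewrite [v in leLHS]row_sum_delta linear_sum.
  apply: le_trans (ler_norm_sum _ _ _) _; rewrite mulr_suml.
  apply: ler_sum => j _; rewrite linearZ normrZ mulrC ler_pM//.
    by apply: le_trans (HM j z zr) (ler_norm _).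
  exact: normr_coord.
exists (\sum_j `|M j|); first exact: sumr_ge0.
move=> x y xr yr.
pose u (t : R) := y + t *: (x - y).
have du t : is_derive t (1 : R) u (x - y).
  apply/is_derive_rV => i.
  rewrite (_ : (fun s => u s ord0 i) = (fun s => y ord0 i + s * (x - y) ord0 i)).
    exact: is_derive_affine.
  by apply/funext => s; rewrite /u !mxE.
have ur t : 0 <= t <= 1 -> `|u t - c| <= r.
  move=> /andP[t0 t1].
  have -> : u t - c = (1 - t) *: (y - c) + t *: (x - c).
    by apply/rowP => i; rewrite /u !mxE; ring.
  apply: le_trans (ler_normD _ _) _; rewrite !normrZ !ger0_norm ?subr_ge0//.
  have := ler_wpM2l t0 xr; have : 0 <= 1 - t by rewrite subr_ge0.
  by move=> /ler_wpM2l /(_ _ _ yr); lra.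
have := @is_derive_dist_le R n (f \o u) (cst (f y)) (fun t => 'd f (u t) (x - y))
  (fun=> 0) (fun t => t * ((\sum_j `|M j|) * `|x - y|))
  (fun=> (\sum_j `|M j|) * `|x - y|) 1 ler01 _ _ _ _ _.
rewrite /= /u scale1r subrKC mul1r mul0r subr0; apply.
- by rewrite /= scale0r addr0.
- by move=> s _; exact: (is_derive_comp_diff (du s) (fC1 _ I).1).
- move=> s _; have := is_derive_affine 0 ((\sum_j `|M j|) * `|x - y|) s.
  by under eq_fun do rewrite add0r.
- by move=> s s01; rewrite subr0; apply: dM; exact: ur.
Qed.

Lemma clamp_lipschitz n (f : 'rV[R]_n -> 'rV[R]_n) c (r L : R) : 0 <= r ->
  0 <= L ->
  (forall x y, `|x - c| <= r -> `|y - c| <= r -> `|f x - f y| <= L * `|x - y|) ->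
  forall x y, `|f (clamp c r x) - f (clamp c r y)| <= L * `|x - y|.
Proof.
move=> r0 L0 fL x y; apply: le_trans (fL _ _ _ _) _; rewrite ?clamp_ball//.
by rewrite ler_wpM2l// clamp_dist.
Qed.

End C1Lipschitz.

Section Gronwall.
Context {R : realType} {n : nat}.

(** The sum of squares [q] of the coordinates of [P - Q] has derivative at most [2 * N * L * q]. The
    constant depends on [n], [L] and [T] only, not on the curves. *)
Lemma gronwall_dist (L T : R) : 0 <= L -> exists2 K : R, 1 <= K &
  forall (P Q dP dQ : R -> 'rV[R]_n),
    (forall s, 0 <= s <= T -> is_derive s (1 : R) P (dP s)) ->
    (forall s, 0 <= s <= T -> is_derive s (1 : R) Q (dQ s)) ->
    (forall s, 0 <= s <= T -> `|dP s - dQ s| <= L * `|P s - Q s|) ->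
  forall t, 0 <= t <= T -> `|P t - Q t| <= K * `|P 0 - Q 0|.
Proof.
move=> L0; pose N : R := n%:R; have N0 : 0 <= N by rewrite ler0n.
(* The squared distance grows at most by the factor [a = N * expR (2 * N * L * T)]; since
   [a <= (a + 1) ^+ 2], taking [K = a + 1] avoids a square root. *)
pose K := N * expR (2 * N * L * T) + 1.
exists K; first by rewrite lerDr mulr_ge0// expR_ge0.
move=> P Q dP dQ Pd Qd dPQ t /andP[t0 tT].
pose d s i := P s ord0 i - Q s ord0 i.
pose dd s i := dP s ord0 i - dQ s ord0 i.
pose q s := \sum_i d s i ^+ 2.
have dq s : 0 <= s <= T -> is_derive s (1 : R) q (\sum_i (d s i * dd s i) *+ 2).
  move=> sT; rewrite (_ : q = \sum_i (fun s => d s i ^+ 2)); last first.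
    by apply/funext => s'; rewrite fct_sumE.
  apply: is_derive_sum => i.
  have H : is_derive s (1 : R) (fun s => d s i) (dd s i).
    by apply: is_deriveB; [exact: (is_derive_rV _ _ _).1 (Pd s sT) i
                          |exact: (is_derive_rV _ _ _).1 (Qd s sT) i].
  exact: is_derive_sqr.
have qE s : q s = \sum_i (P s - Q s) ord0 i ^+ 2.
  by apply: eq_bigr => i _; rewrite !mxE.
have dPQn s : `|P s - Q s| ^+ 2 <= q s by rewrite qE sqr_normr_rV_le.
have q_le s : q s <= N * `|P s - Q s| ^+ 2 by rewrite qE sum_sqr_rV_le.
have qT : q t <= expR (2 * N * L * t) * q 0.
  apply: (gronwall t0 (dq := fun s => \sum_i (d s i * dd s i) *+ 2)).
    by move=> s /andP[s0 st]; apply: dq; rewrite s0 (le_trans st).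
  move=> s /andP[s0 st].
  have sT : 0 <= s <= T by rewrite s0 (le_trans st).
  have H i : d s i * dd s i <= L * `|P s - Q s| ^+ 2.
    apply: le_trans (ler_norm _) _; rewrite normrM mulrC expr2 mulrA ler_pM//.
      have := normr_coord (dP s - dQ s) i; rewrite !mxE => /le_trans; apply.
      exact: dPQ.
    by have := normr_coord (P s - Q s) i; rewrite !mxE.
  apply: (@le_trans _ _ (\sum_(i < n) L * `|P s - Q s| ^+ 2 *+ 2)).
    by apply: ler_sum => i _; rewrite lerMn2r; exact: H.
  rewrite sumr_const card_ord -mulrnA -[_ *+ (2 * n)]mulr_natr natrM -/N.
  by have := ler_wpM2l (mulr_ge0 N0 L0) (dPQn s); nra.
have : `|P t - Q t| ^+ 2 <= (K * `|P 0 - Q 0|) ^+ 2.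
  apply: le_trans (dPQn t) _; apply: le_trans qT _.
  have E0 : 0 <= expR (2 * N * L * T) by exact: expR_ge0.
  have EtT : expR (2 * N * L * t) <= expR (2 * N * L * T).
    by rewrite ler_expR ler_wpM2l// !mulr_ge0.
  apply: (@le_trans _ _ (expR (2 * N * L * T) * (N * `|P 0 - Q 0| ^+ 2))).
    by rewrite ler_pM ?expR_ge0// (le_trans _ (dPQn 0))// sqr_ge0.
  rewrite exprMn mulrA ler_wpM2r ?sqr_ge0// mulrC.
  have := mulr_ge0 N0 E0; rewrite /K; set a := N * _ => a0.
  by rewrite expr2; nra.
by rewrite ler_sqr ?nnegrE// mulr_ge0// addr_ge0// mulr_ge0// expR_ge0.
Qed.

End Gronwall.

(** * Solutions and flow of a C1 vector field *)

Section MoreDerive.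
Context {R : realType}.

Lemma is_derive_cvgP {V : normedModType R} (u : R -> V) (t : R) v :
  is_derive t (1 : R) u v <->
  h^-1 *: (u (h *: 1 + t) - u t) @[h --> 0^'] --> v.
Proof.
split=> [[du <-]|uv]; first exact: du.
by apply: DeriveDef; [apply/cvg_ex; exists v|exact/cvg_lim].
Qed.

Lemma is_derive_glue {V : normedModType R} (u w : R -> V) (t : R) v :
  u t = w t -> is_derive t (1 : R) u v -> is_derive t (1 : R) w v ->
  is_derive t (1 : R) (fun s => if s < t then u s else w s) v.
Proof.
move=> uwt /is_derive_cvgP du /is_derive_cvgP dw.
apply/is_derive_cvgP/cvgrPdist_lt => e e0.
move/cvgrPdist_lt : du => /(_ e e0) du; move/cvgrPdist_lt : dw => /(_ e e0) dw.
near=> h; rewrite ltxx; case: ifPn => _.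
  by rewrite -uwt; near: h; exact: du.
by near: h; exact: dw.
Unshelve. all: by end_near. Qed.

Lemma is_derive_comp_affine n (u : R -> 'rV[R]_n) (a b t : R) v :
  is_derive (a + t * b) (1 : R) u v ->
  is_derive t (1 : R) (fun s => u (a + s * b)) (b *: v).
Proof.
move=> /is_derive_rV du; apply/is_derive_rV => i; rewrite mxE mulrC.
exact: (@is_derive1_comp _ (fun s => u s ord0 i) _ t _ _ (du i)
  (is_derive_affine a b t)).
Qed.

Lemma cvg_pinftyP {V : normedModType R} (u : R -> V) l :
  u @ +oo --> l <->
  forall e : R, 0 < e -> exists T : R, forall t, T <= t -> `|l - u t| < e.
Proof.
split=> [/cvgrPdist_lt ul e e0|ul].
  have [T [_ HT]] := ul e e0; exists (T + 1) => t Tt; apply: HT.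
  by apply: lt_le_trans Tt; rewrite ltrDl.
apply/cvgrPdist_lt => e /ul[T HT]; exists T; split; first exact: num_real.
by move=> t /ltW; exact: HT.
Qed.

End MoreDerive.

Section ODE.
Context {R : realType} {n : nat}.
Implicit Types (f : 'rV[R]_n -> 'rV[R]_n) (x y : 'rV[R]_n) (w u : R -> 'rV[R]_n).

(** The derivatives are two-sided at both end points, which makes the notion stable under time
    reversal. *)
Definition solution_on f (T : R) x w :=
  w 0 = x /\ forall t, 0 <= t <= T -> is_derive t (1 : R) w (f (w t)).

Lemma forward_solution_on f T x u : forward_solution f x u -> solution_on f T x u.
Proof. by case=> u0 du; split => // t /andP[t0 _]; exact: du. Qed.

Lemma solution_on_bounded f T x w : solution_on f T x w ->
  exists M, forall t, 0 <= t <= T -> `|w t| <= M.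
Proof.
move=> [_ dw]; have : compact (w @` `[0, T]).
  apply: continuous_compact; last exact: segment_compact.
  apply: continuous_in_subspaceT => t /[!inE]/= /[!in_itv]/= tT.
  exact: is_derive_continuous (dw t tT).
move=> /compact_bounded[M [_ HM]]; exists (M + 1) => t tT.
by apply: (HM (M + 1)); [rewrite ltrDl|exists t => //=; rewrite in_itv].
Qed.

Lemma solution_on_shift f x u (T : R) : 0 <= T -> forward_solution f x u ->
  forward_solution f (u T) (fun t => u (t + T)).
Proof.
move=> T0 [_ du]; split=> [|t t0]; first by rewrite add0r.
have := @is_derive_comp_affine R n u T 1 t (f (u (t + T))).
rewrite mulr1 addrC scale1r => H.
rewrite (_ : (fun s => u (s + T)) = (fun s => u (T + s * 1))).
  by apply: H; apply: du; rewrite addr_ge0.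
by apply/funext => s; rewrite mulr1 addrC.
Qed.

Lemma solution_on_concat f (T : R) x w u : 0 <= T -> solution_on f T x w ->
  forward_solution f (w T) u ->
  forward_solution f x (fun t => if t < T then w t else u (t - T)).
Proof.
move=> T0 [w0 dw] [u0 du].
have du' t : T <= t -> is_derive t (1 : R) (fun s => u (s - T)) (f (u (t - T))).
  move=> Tt; have := @is_derive_comp_affine R n u (- T) 1 t (f (u (t - T))).
  rewrite mulr1 addrC scale1r => H.
  rewrite (_ : (fun s => _) = (fun s => u (- T + s * 1))).
    by apply: H; apply: du; rewrite subr_ge0.
  by apply/funext => s; rewrite mulr1 addrC.
split=> [|t t0].
  case: ltP => // T0'; have TE : T = 0 by apply/eqP; rewrite eq_le T0 T0'.
  by rewrite TE subrr u0 TE.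
have [tT|Tt|->] := ltgtP t T.
- apply: (@near_eq_is_derive _ _ _ w); last by apply: dw; rewrite t0 ltW.
  by near=> s; rewrite ifT//; near: s; exact: lt_nbhsl.
- apply: (@near_eq_is_derive _ _ _ (fun s => u (s - T))); last exact: du' (ltW Tt).
  by near=> s; rewrite ifN// -leNgt ltW//; near: s; exact: lt_nbhsr.
- apply: is_derive_glue; rewrite ?subrr ?u0//; first by apply: dw; rewrite T0 lexx.
  by have := du' T (lexx T); rewrite subrr u0.
Unshelve. all: by end_near. Qed.

Lemma solution_on_rev f (T : R) x w : solution_on f T x w ->
  solution_on (fun z => - f z) T (w T) (fun t => w (T - t)).
Proof.
move=> [_ dw]; split=> [|t /andP[t0 tT]]; first by rewrite subr0.
have := @is_derive_comp_affine R n w T (-1) t (f (w (T - t))).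
rewrite mulrN1 scaleN1r => H.
rewrite (_ : (fun s => _) = (fun s => w (T + s * -1))).
  by apply: H; apply: dw; rewrite subr_ge0 tT gerBl.
by apply/funext => s; rewrite mulrN1.
Qed.

Section C1.
Variable f : 'rV[R]_n -> 'rV[R]_n.
Hypothesis fC1 : C1_on setT f.

Lemma solution_on_unique (T : R) x w w' :
  solution_on f T x w -> solution_on f T x w' ->
  forall t, 0 <= t <= T -> w t = w' t.
Proof.
move=> sw sw' t tT.
have [[M HM] [M' HM']] := (solution_on_bounded sw, solution_on_bounded sw').
have [L L0 HL] := C1_lipschitz_ball 0 (Num.max M M') fC1.
have [K _ HK] := @gronwall_dist R n L T L0.
have := HK _ _ _ _ sw.2 sw'.2 _ t tT; rewrite sw.1 sw'.1 subrr normr0 mulr0.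
move=> H; apply/eqP; rewrite -subr_eq0 -normr_le0; apply: H => s sT.
by apply: HL; rewrite subr0 le_max ?HM ?HM' ?orbT.
Qed.

(* [delta] depends on the solution only through the bound [M]. *)
Lemma solution_on_tube (T M e : R) : 0 < e -> exists2 d : R, 0 < d &
  forall x w, solution_on f T x w -> (forall t, 0 <= t <= T -> `|w t| <= M) ->
  forall y, `|y - x| < d -> exists2 w', solution_on f T y w' &
    forall t, 0 <= t <= T -> `|w' t - w t| < e.
Proof.
move=> e0; have r0 : 0 <= `|M| + 1 by rewrite addr_ge0.
have [L L0 /(clamp_lipschitz r0 L0) HL] := C1_lipschitz_ball 0 (`|M| + 1) fC1.
have [K K1 HK] := @gronwall_dist R n L T L0.
have K0 : 0 < K by apply: lt_le_trans K1.
(* The minimum with 1 keeps [w'] within distance 1 of [w], hence in the ball of radius [|M| + 1]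
   where the truncated field agrees with [f]. *)
exists (Num.min e 1 / K); first by rewrite divr_gt0// lt_min e0 ltr01.
move=> x w [w0 dw] wM y yx.
have [w' [w'0 dw']] := lipschitz_forward_solution y HL.
have ww' t : 0 <= t <= T -> `|w' t - w t| < Num.min e 1.
  move=> tT; apply: (@le_lt_trans _ _ (K * `|y - x|)).
    rewrite -w0 -w'0; apply: (HK _ _ (fun s => f (clamp 0 (`|M| + 1) (w' s)))
      (fun s => f (clamp 0 (`|M| + 1) (w s)))) => // s sT.
    - by apply: dw'; case/andP: sT.
    - rewrite clamp_id; first exact: dw.
      by rewrite subr0 (le_trans (wM s sT))// (le_trans (ler_norm M))// lerDl.
  by rewrite mulrC -ltr_pdivlMr.
exists w'.
  split=> // t tT; have := dw' t; rewrite clamp_id; first by apply; case/andP: tT.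
  rewrite subr0 -[w' t](subrK (w t)) addrC (le_trans (ler_normD _ _))//.
  have := ww' t tT; rewrite lt_min => /andP[_ /ltW] H.
  by apply: lerD => //; rewrite (le_trans (wM t tT))// ler_norm.
by move=> t tT; have := ww' t tT; rewrite lt_min => /andP[].
Qed.

Lemma flow_forward_solution x u : forward_solution f x u ->
  forward_solution f x (fun t => flow f t x).
Proof.
move=> xu; have xu_ex : exists u, [set u | forward_solution f x u] u by exists u.
exact: xgetPex xu_ex.
Qed.

Lemma flowE x u t : forward_solution f x u -> 0 <= t -> flow f t x = u t.
Proof.
move=> xu t0; have xf := flow_forward_solution xu.
apply: (solution_on_unique (forward_solution_on t xf) (forward_solution_on t xu)).
by rewrite t0 lexx.
Qed.

Variable xs : 'rV[R]_n.
Local Notation B := (basin f xs).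

Lemma basin_forward_solution x : B x -> forward_solution f x (fun t => flow f t x).
Proof. by case=> -[u xu] _; exact: flow_forward_solution xu. Qed.

Lemma flow0 x : B x -> flow f 0 x = x.
Proof. by case/basin_forward_solution. Qed.

Lemma basin_flow x T : B x -> 0 <= T ->
  B (flow f T x) /\ forall t, 0 <= t -> flow f t (flow f T x) = flow f (t + T) x.
Proof.
move=> Bx T0; have sx := solution_on_shift T0 (basin_forward_solution Bx).
have fE t : 0 <= t -> flow f t (flow f T x) = flow f (t + T) x.
  by move=> t0; rewrite (flowE sx).
split=> //; split; first by eexists; exact: sx.
case: Bx => _ /cvg_pinftyP xl; apply/cvg_pinftyP => e e0.
have [S HS] := xl e e0; exists (Num.max S 0) => t; rewrite ge_max => /andP[St t0].
by rewrite fE// HS// (le_trans St)// lerDl.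
Qed.

(** Continuing [w] by the flow from [w T] gives a forward solution from [x] with the same limit. It
    thus suffices to reach the basin in finite time. *)
Lemma solution_on_basin (T : R) x w : 0 <= T -> solution_on f T x w -> B (w T) ->
  B x /\ forall t, 0 <= t <= T -> flow f t x = w t.
Proof.
move=> T0 xw BwT.
have sx := solution_on_concat T0 xw (basin_forward_solution BwT).
have fE t : 0 <= t -> flow f t x = if t < T then w t else flow f (t - T) (w T).
  by move=> t0; rewrite (flowE sx).
split; last first.
  move=> t /andP[t0 tT]; rewrite fE//; case: ltP => // Tt.
  have -> : t = T by apply/eqP; rewrite eq_le tT Tt.
  by rewrite subrr flow0.
split; first by eexists; exact: sx.
case: BwT => _ /cvg_pinftyP xl; apply/cvg_pinftyP => e e0.
have [S HS] := xl e e0; exists (Num.max (S + T) T) => t.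
rewrite ge_max => /andP[St Tt].
by rewrite fE ?(le_trans T0)// [t < T]ltNge Tt HS// lerBrDr.
Qed.

End C1.
End ODE.

(** * Stability of the hyperbolic fixed point *)

Section RealJordan.
Context {R : realType}.
Local Notation reM := (map_mx (@complex.Re R)).
Local Notation imM := (map_mx (@complex.Im R)).

Lemma Re_mulmx m n p (A : 'M[R[i]]_(m, n)) (B : 'M[R[i]]_(n, p)) :
  reM (A *m B) = reM A *m reM B - imM A *m imM B.
Proof.
apply/matrixP => i j; rewrite !mxE raddf_sum -sumrB; apply: eq_bigr => k _.
by rewrite !mxE; case: (A i k) => a b; case: (B k j).
Qed.

Lemma Im_mulmx m n p (A : 'M[R[i]]_(m, n)) (B : 'M[R[i]]_(n, p)) :
  imM (A *m B) = reM A *m imM B + imM A *m reM B.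
Proof.
apply/matrixP => i j; rewrite !mxE raddf_sum -big_split; apply: eq_bigr => k _.
by rewrite !mxE; case: (A i k) => a b; case: (B k j).
Qed.

(** Let [P] diagonalize [J] over the complex numbers, with inverse [Q = QR + i QI], and separate
    real and imaginary parts in [J Q = Q D]. The real part of [Q P = 1] recovers a real vector from
    the two parts of its complex coordinates. *)
Lemma real_diagonalizable n (J : 'M[R]_n) (c : R) :
  diagonalizable (map_mx (real_complex R) J) ->
  (forall mu, eigenvalue (map_mx (real_complex R) J) mu -> complex.Re mu < c) ->
  exists (QR QI PR PI : 'M[R]_n) (dr di : 'rV[R]_n),
  [/\ QR *m PR - QI *m PI = 1%:M,
      J *m QR = QR *m diag_mx dr - QI *m diag_mx di,
      J *m QI = QR *m diag_mx di + QI *m diag_mx dr &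
      forall j, dr ord0 j < c].
Proof.
set A := map_mx _ J => -[P Pu /diagonalizable_forPex[D /(simmxP Pu) PA]] eigA.
have reA : reM A = J by apply/matrixP => i j; rewrite !mxE.
have imA : imM A = 0 by apply/matrixP => i j; rewrite !mxE.
have AQ : A *m invmx P = invmx P *m diag_mx D.
  by rewrite -{1}[A](mulKmx Pu) PA mulmxA mulmxK.
exists (reM (invmx P)), (imM (invmx P)), (reM P), (imM P).
exists (reM D), (imM D).
have reD : reM (diag_mx D) = diag_mx (reM D).
  by apply/matrixP => i j; rewrite !mxE raddfMn.
have imD : imM (diag_mx D) = diag_mx (imM D).
  by apply/matrixP => i j; rewrite !mxE raddfMn.
split.
- by rewrite -Re_mulmx mulVmx//; apply/matrixP => i j; rewrite !mxE; case: eqP.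
- by have /(congr1 reM) := AQ; rewrite !Re_mulmx reA imA mul0mx subr0 reD imD.
- by have /(congr1 imM) := AQ; rewrite !Im_mulmx reA imA mul0mx addr0 reD imD.
(* Row [j] of [P] is an eigenvector for the [j]-th diagonal entry, nonzero because [P] is
   invertible. *)
- move=> j; rewrite mxE; apply: eigA; apply/eigenvalueP; exists (row j P).
    by rewrite -row_mul PA row_mul row_diag_mx -scalemxAl -rowE.
  apply/eqP => rj; have : row j (P *m invmx P) = 0 by rewrite row_mul rj mul0mx.
  rewrite mulmxV// => /rowP/(_ j); rewrite !mxE eqxx => /eqP.
  by rewrite oner_eq0.
Qed.

End RealJordan.

Section Remainder.
Context {R : realType}.

Lemma diff_remainder {V W : normedModType R} (f : V -> W) x (e : R) :
  differentiable f x -> 0 < e ->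
  exists2 d : R, 0 < d & forall y, `|y - x| <= d ->
    `|f y - (f x + 'd f x (y - x))| <= e * `|y - x|.
Proof.
move=> df e0; have := diff_locallyx df.
set o := (X in forall h, _ = _ + X h) => fE.
have /eqoP/(_ e e0)/nbhs_ballP[d /= d0 Hd] : o =o_ (0 : V) id.
  by rewrite /o; exact: littleo_eqo.
exists (d / 2); first by rewrite divr_gt0.
move=> y yx; have -> : f y - (f x + 'd f x (y - x)) = o (y - x).
  by rewrite -[y in f y](subrK x) fE addrC addKr.
apply: Hd; rewrite -ball_normE /ball_/= sub0r normrN (le_lt_trans yx)//.
by rewrite ltr_pdivrMr// ltr_pMr// ltr1n.
Qed.

End Remainder.

Section MatrixBound.
Context {R : realType} {n : nat}.

Lemma normr_mulmx_le (A : 'M[R]_n) : exists2 q, 0 <= q &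
  forall x : 'rV_n, `|x *m A| <= q * `|x|.
Proof.
exists (\sum_i \sum_j `|A i j|).
  by apply: sumr_ge0 => i _; exact: sumr_ge0.
move=> x; have q0 : 0 <= (\sum_i \sum_j `|A i j|) * `|x|.
  by rewrite mulr_ge0//; apply: sumr_ge0 => i _; exact: sumr_ge0.
apply: normr_rV_le => // j; rewrite mxE; apply: le_trans (ler_norm_sum _ _ _) _.
rewrite mulr_suml; apply: ler_sum => i _; rewrite normrM mulrC ler_pM//.
  by rewrite (bigD1 j)//= lerDl; exact: sumr_ge0.
exact: normr_coord.
Qed.

End MatrixBound.

Section Lyapunov.
Context {R : realType} {n : nat}.

Lemma is_derive_mulmx (u : R -> 'rV[R]_n) (A : 'M[R]_n) (t : R) v :
  is_derive t (1 : R) u v -> is_derive t (1 : R) (fun s => u s *m A) (v *m A).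
Proof.
move=> /is_derive_rV du; apply/is_derive_rV => j.
have -> : (fun s => (u s *m A) ord0 j) = \sum_k (fun s => A k j * u s ord0 k).
  by apply/funext => s; rewrite fct_sumE mxE; apply: eq_bigr => k _; rewrite mulrC.
have -> : (v *m A) ord0 j = \sum_k A k j * v ord0 k.
  by rewrite mxE; apply: eq_bigr => k _; rewrite mulrC.
apply: is_derive_sum => k; have := du k => duk; exact: is_deriveZ.
Qed.

(** With [I] the imaginary unit and [i] a real number, the left side is the derivative of [|w|^2]
    for [w = a + b I] and [w' = (r + i I) w + (al + be I)]. The rotation [i] cancels, and Young's
    inequality with weight [k] absorbs the perturbation at the cost of half the decay. *)
Lemma lyapunov_coord (k a b r i al be : R) : 0 < k -> r <= - k ->
  (a * (a * r - b * i + al)) *+ 2 + (b * (a * i + b * r + be)) *+ 2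
    <= - k * (a ^+ 2 + b ^+ 2) + k^-1 * (al ^+ 2 + be ^+ 2).
Proof.
move=> k0 rk.
have H x y : x * y *+ 2 <= k * x ^+ 2 + k^-1 * y ^+ 2.
  have : 0 <= k^-1 * (k * x - y) ^+ 2 by rewrite mulr_ge0 ?sqr_ge0// invr_ge0 ltW.
  have -> : k^-1 * (k * x - y) ^+ 2 = k * x ^+ 2 - x * y *+ 2 + k^-1 * y ^+ 2.
    by field; rewrite gt_eqF.
  by lra.
have H1 := H a al; have H2 := H b be.
have ab0 : 0 <= a ^+ 2 + b ^+ 2 by rewrite addr_ge0 ?sqr_ge0.
have : 0 <= (- k - r) * (a ^+ 2 + b ^+ 2) by rewrite mulr_ge0// subr_ge0.
have -> : (a * (a * r - b * i + al)) *+ 2 + (b * (a * i + b * r + be)) *+ 2 =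
  2 * r * (a ^+ 2 + b ^+ 2) + a * al *+ 2 + b * be *+ 2 by ring.
by lra.
Qed.

(** [V] is the squared Hermitian norm of the coordinates in an eigenbasis, comparable to the squared
    sup norm through [p] and [q]. Summing [lyapunov_coord] gives [V(u)' <= - k V(u) + V(z) / k], and
    a [z] small relative to [u] leaves the rate [k / 2]. *)
Lemma perturbed_linear_decay (J QR QI PR PI : 'M[R]_n) (dr di : 'rV[R]_n) (k : R) :
  QR *m PR - QI *m PI = 1%:M ->
  J *m QR = QR *m diag_mx dr - QI *m diag_mx di ->
  J *m QI = QR *m diag_mx di + QI *m diag_mx dr ->
  0 < k -> (forall j, dr ord0 j <= - k) ->
  exists eta C : R, [/\ 0 < eta, 0 <= C &
    forall u z : R -> 'rV[R]_n,
      (forall t : R, 0 <= t -> is_derive t (1 : R) u (u t *m J + z t)) ->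
      (forall t : R, 0 <= t -> `|z t| <= eta * `|u t|) ->
      forall t : R, 0 <= t -> `|u t| ^+ 2 <= C * expR (- (k / 2) * t) * `|u 0| ^+ 2].
Proof.
move=> QP JQR JQI k0 drk.
have [[qr qr0 Hqr] [qi qi0 Hqi]] := (normr_mulmx_le QR, normr_mulmx_le QI).
have [[pr pr0 Hpr] [pi pi0 Hpi]] := (normr_mulmx_le PR, normr_mulmx_le PI).
pose N : R := n%:R; have N0 : 0 <= N by rewrite ler0n.
pose V (x : 'rV[R]_n) := \sum_j ((x *m QR) ord0 j ^+ 2 + (x *m QI) ord0 j ^+ 2).
pose q := N * (qr ^+ 2 + qi ^+ 2); pose p := 2 * (pr ^+ 2 + pi ^+ 2).
have q0 : 0 <= q by rewrite mulr_ge0// addr_ge0// sqr_ge0.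
have p0 : 0 <= p by rewrite mulr_ge0// addr_ge0// sqr_ge0.
have Vq x : V x <= q * `|x| ^+ 2.
  rewrite /V big_split/= /q -mulrA mulrDl mulrDr.
  apply: lerD; apply: le_trans (sum_sqr_rV_le _) _; rewrite ler_wpM2l//.
    by rewrite -exprMn ler_sqr ?nnegrE ?mulr_ge0.
  by rewrite -exprMn ler_sqr ?nnegrE ?mulr_ge0.
have Vp x : `|x| ^+ 2 <= p * V x.
  have xE : x = x *m QR *m PR - x *m QI *m PI.
    by rewrite -!mulmxA -mulmxBr QP mulmx1.
  have x1 : `|x| <= pr * `|x *m QR| + pi * `|x *m QI|.
    rewrite {1}xE (le_trans (ler_normB _ _))// lerD//.
  have := sqr_normr_rV_le (x *m QR); have := sqr_normr_rV_le (x *m QI).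
  rewrite /V big_split/=; set s2 := \sum_i (x *m QI) _ _ ^+ 2.
  set s1 := \sum_i (x *m QR) _ _ ^+ 2.
  move: `|x *m QR| `|x *m QI| (normr_ge0 (x *m QR)) (normr_ge0 (x *m QI)) x1.
  move=> a b a0 b0 x1 bs as_.
  have : `|x| ^+ 2 <= (pr * a + pi * b) ^+ 2.
    by rewrite ler_sqr ?nnegrE// addr_ge0 ?mulr_ge0.
  move=> /le_trans; apply.
  apply: (@le_trans _ _ (2 * (pr ^+ 2 * a ^+ 2 + pi ^+ 2 * b ^+ 2))).
    by have := sqr_ge0 (pr * a - pi * b); rewrite !expr2; lra.
  rewrite /p -mulrA ler_wpM2l// mulrDl !mulrDr.
  have [prr pii] := (sqr_ge0 pr, sqr_ge0 pi).
  have [b2 a2] := (sqr_ge0 b, sqr_ge0 a).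
  have h1 : pr ^+ 2 * a ^+ 2 <= pr ^+ 2 * s1 by rewrite ler_wpM2l.
  have h2 : pi ^+ 2 * b ^+ 2 <= pi ^+ 2 * s2 by rewrite ler_wpM2l.
  have h3 : 0 <= pr ^+ 2 * s2 by rewrite mulr_ge0// (le_trans b2).
  have h4 : 0 <= pi ^+ 2 * s1 by rewrite mulr_ge0// (le_trans a2).
  by lra.
clearbody p q.
(* This makes [q * eta ^+ 2 * p] at most [k * (k / 2)], because [w <= 2 * (w + 1) ^+ 2] for
   [w = q * p]; the perturbation then costs at most half of the rate [k]. *)
pose eta := k / (2 * (q * p + 1)).
have qp0 : 0 <= q * p by rewrite mulr_ge0.
have eta0 : 0 < eta by rewrite divr_gt0// mulr_gt0// ltr_wpDl.
exists eta, (p * q); split => //; first by rewrite mulr_ge0.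
move=> u z du zu t t0.
pose a s := u s *m QR; pose b s := u s *m QI.
pose da s := (u s *m J + z s) *m QR; pose db s := (u s *m J + z s) *m QI.
have dV s : 0 <= s <= t -> is_derive s (1 : R) (V \o u)
    (\sum_j ((a s ord0 j * da s ord0 j) *+ 2 + (b s ord0 j * db s ord0 j) *+ 2)).
  move=> /andP[s0 _]; have du_s := du s s0.
  have -> : V \o u = \sum_j (fun s => a s ord0 j ^+ 2 + b s ord0 j ^+ 2).
    by apply/funext => s'; rewrite fct_sumE.
  apply: is_derive_sum => j; apply: is_deriveD; apply: is_derive_sqr.
    exact: (is_derive_rV _ _ _).1 (is_derive_mulmx QR du_s) j.
  exact: (is_derive_rV _ _ _).1 (is_derive_mulmx QI du_s) j.
have VT : V (u t) <= expR (- (k / 2) * t) * V (u 0).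
  apply: (gronwall t0 dV) => s /andP[s0 _] /=.
  apply: (@le_trans _ _ (- k * V (u s) + k^-1 * V (z s))).
    rewrite /V !mulr_sumr -big_split/=; apply: ler_sum => j _.
    have -> : da s ord0 j = a s ord0 j * dr ord0 j - b s ord0 j * di ord0 j
                            + (z s *m QR) ord0 j.
      rewrite /da mulmxDl -mulmxA JQR mulmxBr !mulmxA mxE; congr (_ + _).
      by rewrite !mul_mx_diag !mxE.
    have -> : db s ord0 j = a s ord0 j * di ord0 j + b s ord0 j * dr ord0 j
                            + (z s *m QI) ord0 j.
      rewrite /db mulmxDl -mulmxA JQI mulmxDr !mulmxA mxE; congr (_ + _).
      by rewrite !mul_mx_diag !mxE.
    exact: lyapunov_coord.
  have zV : V (z s) <= q * eta ^+ 2 * p * V (u s).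
    have -> : q * eta ^+ 2 * p * V (u s) = q * (eta ^+ 2 * (p * V (u s))) by ring.
    apply: le_trans (Vq _) _; rewrite ler_wpM2l//.
    apply: (@le_trans _ _ ((eta * `|u s|) ^+ 2)).
      have eta_ge0 := ltW eta0; have zus := zu s s0.
      by apply: lerXn2r zus; rewrite nnegrE//; exact: mulr_ge0.
    by rewrite exprMn ler_wpM2l ?sqr_ge0.
  have V0 : 0 <= V (u s) by apply: sumr_ge0 => j _; rewrite addr_ge0 ?sqr_ge0.
  have etaE : q * eta ^+ 2 * p <= k * (k / 2).
    have -> : q * eta ^+ 2 * p = eta ^+ 2 * (q * p) by ring.
    have -> : k * (k / 2) = eta ^+ 2 * (2 * (q * p + 1) ^+ 2).
      by rewrite /eta; field; apply: lt0r_neq0; rewrite ltr_wpDl.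
    by rewrite ler_wpM2l ?sqr_ge0//; move: (q * p) qp0 => w w0; nra.
  have : k^-1 * V (z s) <= k / 2 * V (u s).
    rewrite ler_pdivrMl// mulrA; apply: le_trans zV _.
    by rewrite ler_wpM2r.
  by lra.
apply: le_trans (Vp _) _; rewrite -!mulrA ler_wpM2l//.
apply: le_trans VT _; rewrite mulrCA ler_wpM2l ?expR_ge0//.
Qed.

End Lyapunov.

Section Stability.
Context {R : realType} {n : nat}.
Variables (f : 'rV[R]_n -> 'rV[R]_n) (xs : 'rV[R]_n).
Hypothesis fC1 : C1_on setT f.

Lemma finite_lower_bound (c : 'I_n -> R) : (forall i, 0 < c i) ->
  exists2 k, 0 < k & forall i, k <= c i.
Proof.
move=> c0; exists (\big[Num.min/1]_i c i); first exact: lt_bigmin.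
by move=> i; apply: bigmin_le.
Qed.

(** Near [xs] the remainder [h] of the linearization is small relative to [y - xs]. A solution of
    the truncated equation that starts close enough decays exponentially, hence never leaves the
    ball where the truncation has no effect, and solves the original equation. *)
Lemma stable_basin_ball : stable_hyperbolic f xs ->
  diagonalizable (complex_jacobian f xs) ->
  exists2 e : R, 0 < e & forall x, `|x - xs| < e -> basin f xs x.
Proof.
move=> [fxs0 eig0] Jdiag; set J := 'J f xs in Jdiag eig0 *.
have [QR [QI [PR [PI [dr [di [QP JQR JQI dr0]]]]]]] := real_diagonalizable Jdiag eig0.
have [k k0 drk] : exists2 k, 0 < k & forall j, dr ord0 j <= - k.
  have [j|k k0 Hk] := @finite_lower_bound (fun j => - dr ord0 j).
    by rewrite oppr_gt0.
  by exists k => // j; rewrite lerNr.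
have [eta [C [eta0 C0 decay]]] := perturbed_linear_decay QP JQR JQI k0 drk.
have [d d0 rem] := diff_remainder (fC1 (x := xs) I).1 eta0.
pose h y := f y - (y - xs) *m J.
have hle y : `|y - xs| <= d -> `|h y| <= eta * `|y - xs|.
  by move/rem; rewrite fxs0 add0r -deriveE ?deriveEjacobian//; exact: (fC1 I).1.
have [q q0 Hq] := normr_mulmx_le J.
have [L L0 HL] := C1_lipschitz_ball xs d fC1.
have hL x y : `|x - xs| <= d -> `|y - xs| <= d -> `|h x - h y| <= (L + q) * `|x - y|.
  move=> xd yd; have -> : h x - h y = (f x - f y) - (x - y) *m J.
    rewrite /h !mulmxBl; apply/rowP => i; rewrite !mxE; ring.
  by rewrite (le_trans (ler_normB _ _))// mulrDl lerD// HL.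
(* Only the remainder is truncated, not the linear part, so that the decay estimate holds wherever
   the solution goes. *)
pose g x := (x - xs) *m J + h (clamp xs d x).
have gL x y : `|g x - g y| <= (q + (L + q)) * `|x - y|.
  have -> : g x - g y = (x - y) *m J + (h (clamp xs d x) - h (clamp xs d y)).
    rewrite /g !mulmxBl; apply/rowP => i; rewrite !mxE; ring.
  rewrite (le_trans (ler_normD _ _))// mulrDl lerD//.
  by apply: clamp_lipschitz => //; [exact: ltW|exact: addr_ge0].
have C1 : 0 < C + 1 by rewrite ltr_wpDl.
(* Since [C * (d / (C + 1)) ^+ 2 <= d ^+ 2], the decay estimate keeps the trajectory within [d] of
   [xs]. *)
exists (d / (C + 1)); first by rewrite divr_gt0.
move=> x xe; have [u [u0 du]] := lipschitz_forward_solution x gL.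
have ule (t : R) : 0 <= t ->
    `|u t - xs| ^+ 2 <= C * expR (- (k / 2) * t) * `|x - xs| ^+ 2.
  move=> t0; rewrite -u0.
  apply: (decay (fun t => u t - xs) (fun t => h (clamp xs d (u t)))) => // s s0.
    have dus := du s s0; have := @is_deriveB _ _ _ u (cst xs) s 1 _ 0 dus _.
    by rewrite subr0; apply.
  apply: le_trans (hle _ _) _; first by rewrite clamp_ball// ltW.
  by rewrite ler_wpM2l ?(ltW eta0)// clamp_center// ltW.
have ud (t : R) : 0 <= t -> `|u t - xs| <= d.
  move=> t0; have := ule t t0; rewrite -(@ler_sqr _ `|u t - xs|) ?nnegrE ?(ltW d0)//.
  move=> /le_trans; apply.
  have E1 : expR (- (k / 2) * t) <= 1.
    by rewrite -expR0 ler_expR mulNr oppr_le0 mulr_ge0// divr_ge0// ltW.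
  have x2 : `|x - xs| ^+ 2 <= (d / (C + 1)) ^+ 2.
    by apply: lerXn2r (ltW xe); rewrite nnegrE// divr_ge0// ltW.
  apply: (@le_trans _ _ (C * (d / (C + 1)) ^+ 2)).
    rewrite -mulrA ler_wpM2l//; apply: le_trans x2.
    by rewrite ler_piMl// sqr_ge0.
  rewrite expr_div_n mulrA ler_pdivrMr ?exprn_gt0// mulrC ler_wpM2l ?sqr_ge0//.
  by rewrite expr2; nra.
have xu : forward_solution f x u.
  split => // t t0; have := du t t0; rewrite /g clamp_id ?ud// /h.
  by rewrite subrKC.
split; first by exists u.
apply/cvg_pinftyP => e e0.
pose D := C * `|x - xs| ^+ 2.
have D0 : 0 <= D by rewrite mulr_ge0// sqr_ge0.
(* Once [k / 2 * t >= D / e ^+ 2], the inequality [1 + y <= expR y] brings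
   [D * expR (- (k / 2) * t)] below [e ^+ 2]. *)
exists (D / e ^+ 2 * (2 / k)) => t Tt.
have t0 : 0 <= t.
  by apply: le_trans Tt; rewrite !mulr_ge0 ?invr_ge0 ?sqr_ge0// ltW.
rewrite (flowE fC1 xu t0) distrC -ltr_sqr ?nnegrE ?(ltW e0)//.
apply: le_lt_trans (ule t t0) _; rewrite mulrAC -/D mulNr expRN.
rewrite ltr_pdivrMr ?expR_gt0//.
have e2 : 0 < e ^+ 2 by rewrite exprn_gt0.
apply: (@lt_le_trans _ _ (e ^+ 2 * (1 + k / 2 * t))); last first.
  by rewrite ler_pM2l// expR_ge1Dx.
rewrite mulrDr mulr1; apply: (@le_lt_trans _ _ (e ^+ 2 * (k / 2 * t))).
  have -> : D = D / e ^+ 2 * (2 / k) * (e ^+ 2 * (k / 2)).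
    by field; rewrite !gt_eqF.
  have -> : e ^+ 2 * (k / 2 * t) = t * (e ^+ 2 * (k / 2)) by ring.
  by rewrite ler_wpM2r// mulr_ge0 ?sqr_ge0// divr_ge0// ltW.
by rewrite ltrDr.
Qed.

Section Basin.
Local Notation B := (basin f xs).
Hypothesis ball_basin : exists2 e : R, 0 < e & forall x, `|x - xs| < e -> B x.

Lemma basin_fixed : B xs.
Proof. by have [e e0] := ball_basin; apply; rewrite subrr normr0. Qed.

Lemma basin_eventually_close x e : B x -> 0 < e ->
  exists2 T, 0 <= T & forall t, T <= t -> `|flow f t x - xs| < e.
Proof.
case=> _ /cvg_pinftyP xl e0; have [T HT] := xl e e0.
exists (Num.max T 0); first by rewrite le_max lexx orbT.
by move=> t; rewrite ge_max => /andP[Tt _]; rewrite distrC HT.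
Qed.

(* [d] depends on [x] only through the bounds on its trajectory. *)
Lemma basin_ball_uniform : exists2 e : R, 0 < e &
  forall T M : R, 0 <= T -> exists2 d : R, 0 < d & forall x, B x ->
    (forall t, 0 <= t <= T -> `|flow f t x| <= M) -> `|flow f T x - xs| < e ->
    forall y, `|y - x| < d -> B y.
Proof.
have [e e0 He] := ball_basin; have e20 : 0 < e / 2 by rewrite divr_gt0.
exists (e / 2) => // T M T0; have [d d0 Hd] := solution_on_tube fC1 T M e20.
exists d => // x Bx xM xT y yx.
have [w yw Hw] :=
  Hd _ _ (forward_solution_on T (basin_forward_solution Bx)) xM y yx.
apply: (solution_on_basin fC1 T0 yw _).1; apply: He.
rewrite -(subrKA (flow f T x)) (splitr e).
by apply: le_lt_trans (ler_normD _ _) _; rewrite ltrD// Hw// T0 lexx.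
Qed.

End Basin.
End Stability.

(** * The basin and the eigenfunction *)

Section OrderFacts.
Context {R : realType} {n : nat}.
Implicit Types (x y z : 'rV[R]_n) (d : R).

Lemma dist_vll x y d : `|y - x| < d ->
  vll y (x + const_mx d) /\ vll (x - const_mx d) y.
Proof.
move=> yx; split=> i; have := normr_coord (y - x) i; rewrite !mxE ler_norml;
  by move: yx => /[swap] /andP[]; lra.
Qed.

Lemma vll_gap x y : vll y x -> exists2 d : R, 0 < d &
  forall i, y ord0 i + d <= x ord0 i.
Proof.
move=> yx; have [i|d d0 Hd] := @finite_lower_bound R n (fun i => x ord0 i - y ord0 i).
  by rewrite subr_gt0.
by exists d => // i; rewrite addrC -lerBrDr.
Qed.

Lemma normr_between x y z d c : `|x - c| < d -> `|y - c| < d ->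
  vle x z -> vle z y -> `|z - c| < d.
Proof.
move=> xd yd xz zy; apply: normr_rV_lt => [|i].
  by apply: le_lt_trans xd.
have := normr_coord (x - c) i; have := normr_coord (y - c) i.
have := xz i; have := zy i; rewrite !mxE !ler_norml ltr_norml => h1 h2 h3 h4.
by apply/andP; split; lra.
Qed.

Lemma vll_vle x y : vll x y -> vle x y.
Proof. by move=> xy i; exact: ltW. Qed.

End OrderFacts.

Section Basin.
Context {R : realType} {n : nat}.
Variables (f : 'rV[R]_n -> 'rV[R]_n) (xs : 'rV[R]_n).
Hypothesis fC1 : C1_on setT f.
Local Notation B := (basin f xs).
Hypothesis ball_basin : exists2 e : R, 0 < e & forall x, `|x - xs| < e -> B x.

Lemma basin_ball x : B x -> exists2 d : R, 0 < d & forall y, `|y - x| < d -> B y.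
Proof.
move=> Bx; have [e e0 He] := basin_ball_uniform fC1 ball_basin.
have [T T0 HT] := basin_eventually_close Bx e0.
have [M HM] := solution_on_bounded (forward_solution_on T (basin_forward_solution Bx)).
have [d d0 Hd] := He T M T0.
by exists d => //; apply: (Hd x) => //; exact: HT.
Qed.

Lemma basin_open : open B.
Proof.
rewrite openE => x /basin_ball[d d0 Hd]; apply/nbhs_ballP; exists d => //= y.
by rewrite -ball_normE /ball_/= distrC; exact: Hd.
Qed.

Lemma basin_order_convex : monotone_on f B -> order_convex B.
Proof.
move=> fmono x y Bx By z [xz zy].
have [e e0 He] := basin_ball_uniform fC1 ball_basin.
have [Tx Tx0 HTx] := basin_eventually_close Bx e0.
have [Ty Ty0 HTy] := basin_eventually_close By e0.
pose T := Num.max Tx Ty.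
have T0 : 0 <= T by rewrite le_max Tx0.
have [Mx HMx] := solution_on_bounded (forward_solution_on T (basin_forward_solution Bx)).
have [My HMy] := solution_on_bounded (forward_solution_on T (basin_forward_solution By)).
(* Monotonicity confines the trajectories of basin points between [x] and [y], so one [d] serves
   them all. The [+ 1] provides the strict bounds that [normr_between] asks for. *)
have [d d0 Hd] := He T (Num.max Mx My + 1) T0.
have step w w' : B w -> vle x w -> vle w y -> `|w' - w| < d -> B w'.
  move=> Bw xw wy; apply: (Hd w Bw _ _ w').
    move=> t /andP[t0 tT]; rewrite -[flow f t w]subr0 ltW//.
    apply: (normr_between (x := flow f t x) (y := flow f t y)).
    - by rewrite subr0 ltr_pwDr// le_max HMx// t0.
    - by rewrite subr0 ltr_pwDr// le_max HMy ?orbT// t0.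
    - exact: fmono.
    - exact: fmono.
  apply: (normr_between (x := flow f T x) (y := flow f T y)).
  - by apply: HTx; rewrite le_max lexx.
  - by apply: HTy; rewrite le_max lexx orbT.
  - exact: fmono.
  - exact: fmono.
have [N HN] : exists N : nat, `|z - x| < d * N.+1%:R.
  exists (Num.bound (`|z - x| / d)); rewrite mulrC -ltr_pdivrMr//.
  apply: lt_le_trans (archi_boundP _) _; first by rewrite divr_ge0// ltW.
  by rewrite ler_nat.
pose p k : 'rV[R]_n := x + (k%:R / N.+1%:R) *: (z - x).
have N0 : 0 < N.+1%:R :> R by rewrite ltr0n.
have Bp k : (k <= N.+1)%N -> B (p k).
  elim: k => [_|k IH kN]; first by rewrite /p mul0r scale0r addr0.
  have Bk : B (p k) by apply: IH; exact: ltnW.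
  have k0 : 0 <= k%:R / N.+1%:R :> R by rewrite divr_ge0.
  have k1 : k%:R / N.+1%:R <= 1 :> R by rewrite ler_pdivrMr// mul1r ler_nat ltnW.
  apply: (step (p k)) => //.
  - by move=> i; rewrite !mxE lerDl mulr_ge0// subr_ge0; exact: xz.
  - move=> i; apply: le_trans (zy i); rewrite !mxE -lerBrDl.
    by rewrite ler_piMl// subr_ge0; exact: xz.
  - rewrite /p opprD addrACA subrr add0r -scalerBl -mulrBl -natrB// subSnn.
    rewrite div1r normrZ gtr0_norm ?invr_gt0// mulrC ltr_pdivrMr//.
have := Bp N.+1 (leqnn _); rewrite /p divff ?gt_eqF// scale1r.
by rewrite subrKC.
Qed.

(* A function constant near a point is constant near the image of that point
   under the time-[T] flow, because the flow of [- f] brings a neighbourhood of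
   the image back. *)
Lemma eigenfunction_diff_eq0 (s : 'rV[R]_n -> R) (l : R) m (T c rho : R) v :
  (forall x t, B x -> 0 <= t -> s (flow f t x) = expR (l * t) * s x) ->
  B m -> 0 <= T -> 0 < rho ->
  (forall p, `|p - m| < rho -> B p /\ s p = c) ->
  differentiable s (flow f T m) ->
  'd s (flow f T m) v = 0.
Proof.
move=> s_eig Bm T0 rho0 sc ds.
have NfC1 : C1_on setT (fun z => - f z) by exact: C1_on_opp.
have sm := forward_solution_on T (basin_forward_solution Bm).
have rsm := solution_on_rev sm.
have [M HM] := solution_on_bounded rsm.
have [d d0 Hd] := solution_on_tube NfC1 T M rho0.
(* The reversed solution from [q] ends at a point [w T] near [m], where [s] equals [c]; run
   forwards, it leads from [w T] to [q] in time [T]. *)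
have s_const q : `|q - flow f T m| < d -> s q = expR (l * T) * c.
  move=> qd; have [w wq Hw] := Hd _ _ rsm HM q qd.
  have TT : 0 <= T <= T by rewrite T0 lexx.
  have wm : `|w T - m| < rho by have := Hw T TT; rewrite subrr (flow0 Bm).
  have [Bw sw] := sc _ wm.
  have := solution_on_rev wq; rewrite (_ : (fun z => - - f z) = f); last first.
    by apply/funext => z; rewrite opprK.
  move=> rw.
  have sw' := forward_solution_on T (basin_forward_solution Bw).
  have := solution_on_unique fC1 rw sw' TT.
  by rewrite subrr wq.1 => ->; rewrite s_eig// sw.
rewrite -deriveE//; rewrite (@near_eq_derive _ _ _ _ (cst (expR (l * T) * c))).
  exact: derive_cst.
apply/nbhs_ballP; exists d => //= q.
by rewrite -ball_normE /ball_/= distrC => /s_const.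
Qed.

Lemma eigenfunction_strictly_increasing (s : 'rV[R]_n -> R) (l : R) v x y :
  monotone_on f B -> dominant_eigenfunction f xs l v s -> increasing_on B s ->
  B x -> B y -> vll y x -> s y < s x.
Proof.
move=> fmono [sC1 _ s_eig dsv] s_inc Bx By yx.
rewrite lt_neqAle; apply/andP; split; last by apply: s_inc => //; exact: vll_vle.
apply/eqP => sxy.
have [d d0 Hd] := vll_gap yx.
pose m : 'rV[R]_n := y + const_mx (d / 2).
have d20 : 0 < d / 2 by rewrite divr_gt0.
(* Such a [p] lies between [y] and [x], so [s p] is squeezed between two equal values. *)
have sm p : `|p - m| < d / 2 -> B p /\ s p = s y.
  move=> pm; have [pu pl] := dist_vll pm.
  have yp : vle y p.
    by move=> i; have := pl i; rewrite !mxE; lra.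
  have px : vle p x.
    by move=> i; have := pu i; have := Hd i; rewrite !mxE; lra.
  have Bp : B p by apply: (basin_order_convex fmono By Bx).
  split => //; apply: le_anti; rewrite [s y in X in X && _]sxy; apply/andP.
  by split; apply: s_inc.
have [Bm _] : B m /\ s m = s y by apply: sm; rewrite subrr normr0.
have ds0 (t : R) : 0 <= t -> 'd s (flow f t m) v = 0.
  move=> t0; apply: (eigenfunction_diff_eq0 v s_eig Bm t0 d20 sm).
  exact: (sC1 _ (basin_flow fC1 Bm t0).1).1.
pose g (t : R) : R := 'd s (flow f t m) v.
have gE (t : R) : 0 <= t -> g t = 0 by exact: ds0.
(* Continuity of the differential at [xs] and the normalization give the limit 1, although [g]
   vanishes at all nonnegative times. *)
have g1 : g t @[t --> +oo] --> (1 : R).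
  have cds := (sC1 _ (basin_fixed ball_basin)).2 v.
  by rewrite -dsv; exact: (cvg_comp _ _ Bm.2 cds).
have [T] := (cvg_pinftyP g 1).1 g1 1 ltr01.
move=> /(_ (Num.max T 0)); rewrite le_max lexx gE ?le_max ?lexx ?orbT//.
by rewrite subr0 normr1 ltxx => /(_ isT).
Qed.

End Basin.

(** * Lipschitz graphs and the boundary of open order-convex sets *)

Section Graph.
Context {R : realType} {m : nat}.
Implicit Types (x y : 'rV[R]_m.+1) (p q : 'rV[R]_m) (t : R).

(** Coordinates on the quotient by the direction [(1,...,1)]. The first coordinate of a point serves
    as its height, and [diag_lift p t] is the point of height [t] over [p]. *)
Definition diag_proj x : 'rV[R]_m := \row_j (x ord0 (lift ord0 j) - x ord0 ord0).
Definition diag_lift p t : 'rV[R]_m.+1 :=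
  \row_i (if unlift ord0 i is Some j then t + p ord0 j else t).

Lemma diag_liftK x : diag_lift (diag_proj x) (x ord0 ord0) = x.
Proof.
by apply/rowP => i; rewrite mxE; case: unliftP => [j|] ->//; rewrite mxE subrKC.
Qed.

Lemma diag_projK p t : diag_proj (diag_lift p t) = p.
Proof. by apply/rowP => j; rewrite !mxE liftK unlift_none addrAC subrr add0r. Qed.

Lemma diag_liftD p t s : diag_lift p t + const_mx s = diag_lift p (t + s).
Proof. by apply/rowP => i; rewrite !mxE; case: unlift => [j|]//; rewrite addrAC. Qed.

Lemma diag_proj_dist x y : `|diag_proj x - diag_proj y| <= 2 * `|x - y|.
Proof.
apply: normr_rV_le => [|j]; first by rewrite mulr_ge0.
have := normr_coord (x - y) (lift ord0 j); have := normr_coord (x - y) ord0.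
by rewrite !mxE !ler_norml => /andP[h1 h2] /andP[h3 h4]; apply/andP; split; lra.
Qed.

Lemma diag_lift_dist p q t s :
  `|diag_lift p t - diag_lift q s| <= `|p - q| + `|t - s|.
Proof.
apply: normr_rV_le => [|i]; first by rewrite addr_ge0.
have := ler_norm (t - s); have := ler_norm (s - t); rewrite [`|s - t|]distrC.
rewrite !mxE; case: unliftP => [j|] _; rewrite ler_norml.
  have := normr_coord (p - q) j; rewrite !mxE ler_norml => /andP[h1 h2] h3 h4.
  by apply/andP; split; lra.
by have := normr_ge0 (p - q) => h1 h2 h3; apply/andP; split; lra.
Qed.

Lemma manifold_graph (A : set 'rV[R]_m.+1) :
  (forall x y, A x -> A y -> ~ vll y x) ->
  (forall x, A x -> exists2 d : R, 0 < d &
     forall y, `|y - x| < d -> exists t, A (y + const_mx t)) ->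
  manifold m A.
Proof.
move=> antiA locA x Ax; have [d d0 Hd] := locA x Ax.
(* The height at which the line over [p] meets [A]. The default 0 is taken only on lines that miss
   [A], and none of those over [D] does. *)
pose tau p := xget 0 [set t | A (diag_lift p t)].
pose D : set 'rV[R]_m := [set p | `|p - diag_proj x| < d].
have DE : D = ball (diag_proj x) d.
  by apply/funext => p; rewrite -ball_normE /D/= distrC.
have oD : open D by rewrite DE; exact: ball_open.
have Atau p : D p -> A (diag_lift p (tau p)).
  move=> Dp; have [|t] := Hd (diag_lift p (x ord0 ord0)).
    rewrite -[x in _ - x]diag_liftK (le_lt_trans (diag_lift_dist _ _ _ _))//.
    by rewrite subrr normr0 addr0.
  by rewrite diag_liftD => At; exact: (@xgetPex _ 0 [set t | A (diag_lift p t)]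
    (ex_intro _ _ At)).
(* A height gap larger than [|p - q|] outweighs every difference of coordinates and would put one
   point of [A] strictly above another. Hence [tau] is 1-Lipschitz on [D]. *)
have heights p q t s : A (diag_lift p t) -> A (diag_lift q s) -> t - s <= `|p - q|.
  move=> At As; rewrite leNgt; apply/negP => ts; apply: (antiA _ _ At As) => i.
  rewrite !mxE; case: unliftP => [j|] _; last first.
    by rewrite -subr_gt0 (le_lt_trans _ ts).
  by have := normr_coord (p - q) j; rewrite !mxE ler_norml => /andP[]; lra.
have tau_dist p q : D p -> D q -> `|tau p - tau q| <= `|p - q|.
  move=> /Atau Ap /Atau Aq; rewrite ler_norml lerNl opprB.
  apply/andP; split; last exact: heights.
  by rewrite distrC; exact: heights.
have tauE y : A y -> D (diag_proj y) -> tau (diag_proj y) = y ord0 ord0.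
  move=> Ay /Atau At; have Ay' : A (diag_lift (diag_proj y) (y ord0 ord0)).
    by rewrite diag_liftK.
  have := heights _ _ _ _ At Ay'; have := heights _ _ _ _ Ay' At.
  by rewrite subrr normr0; lra.
have imD : diag_proj @` (A `&` (diag_proj @^-1` D)) = D.
  apply/seteqP; split=> [_ [y [_ Dy] <-]//|p Dp].
  exists (diag_lift p (tau p)); last by rewrite diag_projK.
  by split; [exact: Atau|rewrite /preimage/= diag_projK].
exists (diag_proj @^-1` D), diag_proj, (fun p => diag_lift p (tau p)); split.
- split; last by rewrite /D/= subrr normr0.
  apply: open_comp => // y _; exact: lipschitz_continuous diag_proj_dist y.
- by rewrite imD.
- by apply: continuous_subspaceT; exact: lipschitz_continuous diag_proj_dist.
- rewrite imD continuous_open_subspace// => p /[!inE] Dp.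
  apply/(@cvgrPdist_lt _ _ _ (nbhs p)) => e e0.
  have : nbhs p (D `&` ball p (e / 2)).
    apply: filterI; first exact: open_nbhs_nbhs.
    by apply: nbhsx_ballx; rewrite divr_gt0.
  apply: filterS => q [Dq]; rewrite -ball_normE /ball_/= => pq.
  apply: le_lt_trans (diag_lift_dist _ _ _ _) _; rewrite (splitr e).
  by rewrite ltrD// (le_lt_trans (tau_dist _ _ Dp Dq)).
- by move=> y [Ay Dy]; rewrite tauE// diag_liftK.
Qed.

End Graph.

Section OrderConvexFrontier.
Context {R : realType} {n : nat}.
Implicit Types (A B : set 'rV[R]_n) (x y : 'rV[R]_n).

Lemma closure_normP A x :
  closure A x <-> forall d : R, 0 < d -> exists2 y, A y & `|y - x| < d.
Proof.
split=> [cA d d0|H U /nbhs_ballP[d /= d0 dU]].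
  have [y [Ay]] := cA _ (nbhsx_ballx x _ d0).
  by rewrite -ball_normE /ball_/= distrC; exists y.
have [y Ay yx] := H d d0; exists y; split => //; apply: dU.
by rewrite -ball_normE /ball_/= distrC.
Qed.

Lemma open_normP B : open B <->
  forall x, B x -> exists2 d : R, 0 < d & forall y, `|y - x| < d -> B y.
Proof.
rewrite openE; split=> [oB x /oB /nbhs_ballP[d /= d0 dB]|oB x /oB[d d0 dB]].
  by exists d => // y yx; apply: dB; rewrite -ball_normE /ball_/= distrC.
apply/nbhs_ballP; exists d => //= y; rewrite -ball_normE /ball_/= distrC.
exact: dB.
Qed.

Lemma open_frontierE B x : open B -> frontier B x <-> closure B x /\ ~ B x.
Proof. by move=> oB; rewrite /frontier ((interior_id _).1 oB). Qed.

Lemma closure_vll_lower A x y : closure A x -> vll x y -> exists2 z, A z & vll z y.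
Proof.
move=> /closure_normP cA /vll_gap[d d0 Hd]; have [z Az /dist_vll[zx _]] := cA d d0.
by exists z => // i; have := zx i; have := Hd i; rewrite !mxE => h1 /lt_le_trans; apply.
Qed.

Lemma closure_vll_upper A x y : closure A x -> vll y x -> exists2 z, A z & vll y z.
Proof.
move=> /closure_normP cA /vll_gap[d d0 Hd]; have [z Az /dist_vll[_ xz]] := cA d d0.
by exists z => // i; have := xz i; have := Hd i; rewrite !mxE; lra.
Qed.

Lemma minimal_antichain B x y :
  minimal_elements B (frontier B) x -> minimal_elements B (frontier B) y -> ~ vll y x.
Proof. by move=> [_ minx] [[cy _] _] /(closure_vll_lower cy)[z Bz /minx]; apply. Qed.

(** On the way down the diagonal from [b], take the infimum of the times outside [B]: that point is
    itself outside because [B] is open, and it is a limit of points at earlier times, which are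
    inside. *)
Lemma frontier_exit B b (d : R) : open B -> B b -> 0 < d -> ~ B (b - const_mx d) ->
  exists t : R, [/\ 0 < t, t <= d & frontier B (b - const_mx t)].
Proof.
move=> oB Bb d0 nBd; pose E := [set t : R | 0 <= t <= d /\ ~ B (b - const_mx t)].
have Ed : E d by split => //; rewrite lexx ltW.
have hE : has_inf E.
  by split; [exists d|exists 0 => t [/andP[]]].
pose t0 := inf E.
have t00 : 0 <= t0 by apply: lb_le_inf; [exists d|move=> t [/andP[]]].
have t0d : t0 <= d by apply: ge_inf => //; exact: hE.2.
have dist_const (s t : R) : `|(b - const_mx s) - (b - const_mx t)| <= `|s - t|.
  apply: normr_rV_le => // i; rewrite !mxE.
  have -> : b ord0 i - s - (b ord0 i - t) = - (s - t) by ring.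
  by rewrite normrN.
have nB : ~ B (b - const_mx t0).
  move=> /((open_normP B).1 oB)[r r0 Hr].
  have [t Et tr] := inf_adherent r0 hE; case: (Et) => _; apply; apply: Hr.
  apply: le_lt_trans (dist_const _ _) _.
  have t0t : t0 <= t by apply: ge_inf => //; exact: hE.2.
  by rewrite ger0_norm ?subr_ge0// ltrBlDl.
have t0_gt0 : 0 < t0.
  rewrite lt_neqAle t00 andbT; apply/eqP => t0E; apply: nB.
  by rewrite -t0E (_ : b - const_mx 0 = b)//; apply/rowP => i; rewrite !mxE subr0.
exists t0; split => //; apply/open_frontierE => //; split=> //.
apply/closure_normP => e e0.
pose s := Num.max 0 (t0 - e / 2).
have s0 : 0 <= s by rewrite le_max lexx.
have st0 : s < t0 by rewrite gt_max t0_gt0 gtrBl divr_gt0.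
exists (b - const_mx s).
  apply: contrapT => nBs.
  have : t0 <= s.
    apply: ge_inf; first exact: hE.2.
    by split => //; rewrite s0 (le_trans (ltW st0)).
  by rewrite leNgt st0.
apply: le_lt_trans (dist_const _ _) _.
rewrite distrC ger0_norm ?subr_ge0 ?ltW//.
have : t0 - e / 2 <= s by rewrite le_max lexx orbT.
by move: s s0 st0 => s s0 st0; lra.
Qed.

Section OpenConvex.
Variable B : set 'rV[R]_n.
Hypotheses (oB : open B) (cB : order_convex B).
Local Notation Mn := (minimal_elements B (frontier B)).
Local Notation Mx := (maximal_elements B (frontier B)).

(** A frontier point with points of [B] both strictly above and strictly below it would belong to
    [B] by order-convexity, but [B] is open. *)
Lemma frontier_minimal_maximal : frontier B = Mn `|` Mx.
Proof.
apply/seteqP; split=> [y fy|y [] []//].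
have [[u Bu yu]|noup] := pselect (exists2 u, B u & vll y u); last first.
  by right; split=> // z yz Bz; apply: noup; exists z.
left; split=> // z zy Bz; have [_ nBy] := (open_frontierE _ oB).1 fy; apply: nBy.
by apply: (cB Bz Bu); split; exact: vll_vle.
Qed.

Lemma frontier_below_minimal y z : frontier B y -> vll y z -> B z -> (Mn `\` Mx) y.
Proof.
move=> fy yz Bz; have nMx : ~ Mx y by case=> _ /(_ z yz); apply.
by split=> //; have := fy; rewrite {1}frontier_minimal_maximal => -[].
Qed.

(** As [x] is not maximal, some [z] in [B] is strictly above it. Order-convexity then puts [b],
    slightly above [x], into [B], while minimality keeps [b - const_mx (d / 2)], which is below [x],
    out of it. The line through [y] leaves [B] in between, at a point with [b] above it. *)
Lemma minimal_local_graph x : (Mn `\` Mx) x -> exists2 d : R, 0 < d &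
  forall y, `|y - x| < d -> exists t, (Mn `\` Mx) (y + const_mx t).
Proof.
move=> [[fx minx] nMx]; have [cx _] := (open_frontierE _ oB).1 fx.
have [z [xz Bz]] : exists z, vll x z /\ B z.
  apply: contrapT => noz; apply: nMx; split=> // z xz Bz.
  by apply: noz; exists z.
have [d d0 Hd] := vll_gap xz.
exists (d / 4) => [|y yx]; first by rewrite divr_gt0.
have [yu yl] := dist_vll yx; pose b := y + const_mx (d / 4).
have xb : vll x b by move=> i; have := yl i; rewrite !mxE; lra.
have bz : vle b z by move=> i; have := yu i; have := Hd i; rewrite !mxE; lra.
have Bb : B b.
  have [w Bw wb] := closure_vll_lower cx xb.
  by apply: (cB Bw Bz); split=> //; exact: vll_vle.
have nBb : ~ B (b - const_mx (d / 2)).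
  by apply: minx => i; have := yu i; rewrite !mxE; lra.
have [|t [t0 _ ft]] := frontier_exit oB Bb _ nBb; first by rewrite divr_gt0.
exists (d / 4 - t).
have -> : y + const_mx (d / 4 - t) = b - const_mx t.
  by apply/rowP => i; rewrite !mxE addrA.
apply: (frontier_below_minimal ft _ Bb) => i.
by rewrite !mxE gtrBl.
Qed.

(** Minimality and membership in the frontier pass to limits. Conversely, from a point of [B] near a
    minimal [y], a short descent along the diagonal meets the frontier at a point below a point of
    [B], hence not maximal. *)
Lemma minimal_closure : closure (Mn `\` Mx) = Mn.
Proof.
apply/seteqP; split=> y.
  move=> cy; have Mnc : closure Mn y by apply: closure_subset cy => z [].
  split; last first.
    move=> z zy Bz; have [w [_ minw] zw] := closure_vll_upper Mnc zy.
    exact: minw zw Bz.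
  apply/open_frontierE => //; split.
    apply/closure_normP => d d0.
    have d20 : 0 < d / 2 by rewrite divr_gt0.
    have [w [/(open_frontierE _ oB)[/closure_normP cw _] _] wy] :=
      (closure_normP _ _).1 Mnc _ d20.
    have [z Bz zw] := cw _ d20; exists z => //.
    rewrite -(subrKA w) (splitr d).
    by rewrite (le_lt_trans (ler_normD _ _))// ltrD.
  move=> /((open_normP B).1 oB)[d d0 Hd].
  have [w [/(open_frontierE _ oB)[_ nBw] _] wy] := (closure_normP _ _).1 Mnc _ d0.
  exact/nBw/Hd.
move=> [fy miny]; have [/closure_normP cy _] := (open_frontierE _ oB).1 fy.
apply/closure_normP => e e0; have e20 : 0 < e / 2 by rewrite divr_gt0.
have [b Bb by_] := cy _ e20.
have [_ bl] := dist_vll by_.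
have nBb : ~ B (b - const_mx (e / 2)).
  by apply: miny => i; have := (dist_vll by_).1 i; rewrite !mxE; lra.
have [t [t0 te ft]] := frontier_exit oB Bb e20 nBb.
exists (b - const_mx t).
  by apply: (frontier_below_minimal ft _ Bb) => i; rewrite !mxE gtrBl.
rewrite addrAC (splitr e) (le_lt_trans (ler_normB _ _))// ltr_leD//.
by apply: normr_rV_le => [|i]; rewrite ?mxE ?gtr0_norm// ltW.
Qed.

End OpenConvex.

(** Reflection through the origin reverses the order, which carries the results on minimal elements
    over to maximal ones. *)
Definition oppS A : set 'rV[R]_n := [set x | A (- x)].

Lemma closure_oppS A : closure (oppS A) = oppS (closure A).
Proof.
apply/seteqP; split=> x /closure_normP cA; apply/closure_normP => d /cA[y Ay yx];
  exists (- y); rewrite /oppS/= ?opprK//.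
- by rewrite addrC distrC.
- by rewrite -opprD normrN; move: yx; rewrite opprK.
Qed.

Lemma open_oppS B : open B -> open (oppS B).
Proof.
move=> /open_normP oB; apply/open_normP => x /oB[d d0 Hd].
by exists d => // y yx; apply: Hd; rewrite -opprD normrN.
Qed.

Lemma frontier_oppS B : open B -> frontier (oppS B) = oppS (frontier B).
Proof.
move=> oB; rewrite /frontier closure_oppS ((interior_id _).1 oB).
by rewrite ((interior_id _).1 (open_oppS oB)).
Qed.

Lemma order_convex_oppS B : order_convex B -> order_convex (oppS B).
Proof.
move=> cB x y Bx By z [xz zy]; apply: (cB _ _ By Bx).
by split=> i; rewrite !mxE lerN2.
Qed.

Lemma vll_opp x y : vll (- x) (- y) <-> vll y x.
Proof. by split=> xy i; have := xy i; rewrite !mxE ltrN2. Qed.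

Lemma minimal_oppS B : open B -> minimal_elements (oppS B) (frontier (oppS B)) =
  oppS (maximal_elements B (frontier B)).
Proof.
move=> oB; rewrite frontier_oppS//; apply/seteqP; split=> x [fx Hx]; split=> // z xz.
  by move=> Bz; apply: (Hx (- z)); [apply/vll_opp; rewrite opprK|rewrite /oppS/= opprK].
by apply: Hx; apply/vll_opp.
Qed.

Lemma maximal_oppS B : open B -> maximal_elements (oppS B) (frontier (oppS B)) =
  oppS (minimal_elements B (frontier B)).
Proof.
move=> oB; rewrite frontier_oppS//; apply/seteqP; split=> x [fx Hx]; split=> // z xz.
  by move=> Bz; apply: (Hx (- z)); [apply/vll_opp; rewrite opprK|rewrite /oppS/= opprK].
by apply: Hx; apply/vll_opp.
Qed.

Lemma maximal_antichain B x y : open B ->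
  maximal_elements B (frontier B) x -> maximal_elements B (frontier B) y -> ~ vll y x.
Proof.
move=> oB Mx My /vll_opp; apply: (@minimal_antichain (oppS B));
  by rewrite minimal_oppS// /oppS/= opprK.
Qed.

End OrderConvexFrontier.

Section OpenConvexManifold.
Context {R : realType} {m : nat}.
Variable B : set 'rV[R]_m.+1.
Hypotheses (oB : open B) (cB : order_convex B).
Local Notation Mn := (minimal_elements B (frontier B)).
Local Notation Mx := (maximal_elements B (frontier B)).

Lemma minimal_manifold_with_edge : manifold_with_edge m Mn Mx.
Proof.
split; last exact: minimal_closure.
apply: manifold_graph; last exact: minimal_local_graph.
by move=> x y [Mx _] [My _]; exact: minimal_antichain My.
Qed.

Lemma maximal_manifold_with_edge : manifold_with_edge m Mx Mn.
Proof.
have E : oppS (Mx `\` Mn) = oppS Mx `\` oppS Mn by [].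
split.
  apply: manifold_graph => [x y [Mx _] [My _]|x Hx]; first exact: maximal_antichain My.
  have := @minimal_local_graph R _ (oppS B) (open_oppS oB) (order_convex_oppS cB) (- x).
  rewrite minimal_oppS// maximal_oppS// -E /oppS/= opprK => /(_ Hx)[d d0 Hd].
  exists d => // y yx; have [|t] := Hd (- y); first by rewrite addrC distrC.
  move=> Ht; exists (- t); move: Ht.
  rewrite (_ : - (- y + const_mx t) = y + const_mx (- t))//.
  by apply/rowP => i; rewrite !mxE opprD opprK.
have := minimal_closure (open_oppS oB) (order_convex_oppS cB).
rewrite minimal_oppS// maximal_oppS// -E closure_oppS => H.
apply/seteqP; split=> x Hx.
  have : oppS (closure (Mx `\` Mn)) (- x) by rewrite /oppS/= opprK.
  by rewrite H /oppS/= opprK.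
have : oppS Mx (- x) by rewrite /oppS/= opprK.
by rewrite -H /oppS/= opprK.
Qed.

End OpenConvexManifold.

(** * Connectedness and level sets *)

(** A nonempty relatively clopen part [D] of [K] meets [C], which is dense in [K]; connectedness of
    [C] puts [C] inside [D], and closedness of [D] in [K] does the rest. *)
Lemma connected_between (T : topologicalType) (C K : set T) :
  connected C -> C `<=` K -> K `<=` closure C -> connected K.
Proof.
move=> cC CK KC D [p Dp] [U oU DU] [F cF DF].
have CU : C `&` D = C.
  apply: cC.
  - move: Dp; rewrite DU => -[Kp Up].
    have [q [Cq Uq]] := KC p Kp U (open_nbhs_nbhs (conj oU Up)).
    by exists q; split=> //; split=> //; exact: CK.
  - exists U => //; rewrite DU; apply/seteqP; split=> [x [Cx []]|x [Cx Ux]]//.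
    by split=> //; split=> //; exact: CK.
  - exists F => //; rewrite DF; apply/seteqP; split=> [x [Cx []]|x [Cx Fx]]//.
    by split=> //; split=> //; exact: CK.
rewrite DF; apply/seteqP; split=> [x []//|x Kx]; split=> //.
have CF : C `<=` F by move=> y; rewrite -CU DF => -[_ []].
by apply: cF; exact: closure_subset CF _ (KC _ Kx).
Qed.

Section Assembly.
Context {R : realType} {n : nat}.
Variables (f : 'rV[R]_n -> 'rV[R]_n) (xs : 'rV[R]_n).
Local Notation B := (basin f xs).

(** [A] is the union of the orbits of its points, each joined with [xs]. An orbit is the continuous
    image of a half-line and has [xs] in its closure, so these pieces are connected, and they share
    [xs]. *)
Lemma invariant_connected (A : set 'rV[R]_n) : A `<=` B -> A xs ->
  (forall x t, A x -> 0 <= t -> A (flow f t x)) -> connected A.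
Proof.
move=> AB Axs Aflow.
pose orb x := [set flow f t x | t in `[0, +oo[ ].
have -> : A = \bigcup_(x in A) (orb x `|` [set xs]).
  apply/seteqP; split=> [x Ax|y [x Ax [[t]|->]]//].
    exists x => //; left; exists 0; first by rewrite /= in_itv/= lexx.
    exact: flow0 (AB x Ax).
  by rewrite /= in_itv/= andbT => t0 <-; exact: Aflow.
apply: bigcup_connected; first by exists xs => x _; right.
move=> x Ax; have Bx := AB x Ax.
apply: (@connected_between _ (orb x)).
- apply: connected_continuous_connected.
    by apply/connected_intervalP; exact: interval_is_interval.
  apply: continuous_in_subspaceT => t /[!inE]/= /[!in_itv]/= /andP[t0 _].
  exact: is_derive_continuous ((basin_forward_solution Bx).2 t t0).
- by move=> y; left.
- move=> y [|->]; first exact: subset_closure.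
  apply/closure_normP => d d0.
  have [T T0 HT] := basin_eventually_close Bx d0.
  exists (flow f T x); last exact: HT.
  by exists T => //=; rewrite in_itv/= T0.
Qed.

End Assembly.

Section LevelSets.
Context {R : realType} {n : nat}.
Variables (B : set 'rV[R]_n) (s : 'rV[R]_n -> R).
Hypothesis oB : open B.
Hypothesis sc : forall x, B x -> {for x, continuous s}.
Hypothesis s_strict : forall x y, B x -> B y -> vll y x -> s y < s x.

Lemma diagonal_dist (x y : 'rV[R]_n) (d t : R) : `|y - x| <= d -> `|t| <= d ->
  `|y + const_mx t - x| <= 2 * d.
Proof.
move=> yx td; have d0 : 0 <= d by apply: le_trans td.
apply: normr_rV_le => [|i]; first by rewrite mulr_ge0.
have := normr_coord (y - x) i; rewrite !mxE => /le_trans/(_ yx).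
by move: td; rewrite !ler_norml => /andP[h1 h2] /andP[h3 h4]; apply/andP; split; lra.
Qed.

Lemma level_antichain r x y : B x /\ s x = r -> B y /\ s y = r -> ~ vll y x.
Proof. by move=> [Bx sx] [By sy] /(s_strict Bx By); rewrite sx sy ltxx. Qed.

Lemma level_neighbours x (e : R) : B x -> 0 < e ->
  exists z w, [/\ B z, B w, vll z x, vll x w & s x - e < s z /\ s w < s x + e].
Proof.
move=> Bx e0; have [d d0 Hd] := (open_normP B).1 oB x Bx.
have /(@cvgrPdist_lt _ _ _ (nbhs x))/(_ e e0)/nbhs_ballP[k /= k0 Hk] := sc Bx.
pose r := Num.min d k / 2.
have r0 : 0 < r by rewrite divr_gt0// lt_min d0.
have close t : `|t| <= r -> B (x + const_mx t) /\ `|s x - s (x + const_mx t)| < e.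
  move=> tr; have xt : `|x + const_mx t - x| < Num.min d k.
    rewrite addrAC subrr add0r (@le_lt_trans _ _ r)//.
      by apply: normr_rV_le => [|i]; [exact: ltW|rewrite mxE].
    by rewrite /r ltr_pdivrMr// ltr_pMr ?ltr1n// lt_min d0.
  move: xt; rewrite lt_min => /andP[xd xk]; split; first exact: Hd.
  by apply: Hk; rewrite -ball_normE /ball_/= distrC.
exists (x + const_mx (- r)), (x + const_mx r).
have [|Bz sz] := close (- r); first by rewrite normrN ger0_norm// ltW.
have [|Bw sw] := close r; first by rewrite ger0_norm// ltW.
split=> //; [by move=> i; rewrite !mxE; lra..|].
by move: sz sw; rewrite !ltr_norml => /andP[h1 h2] /andP[h3 h4]; split; lra.
Qed.

(** At parameters [- e] and [e] the diagonal line through [y] is strictly below and strictly above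
    [x], so the intermediate value theorem finds level [r] in between. With [e = d / 4] this stretch
    of the line stays within [d] of [x], inside [B]. *)
Lemma level_local_graph r x : B x /\ s x = r -> exists2 d : R, 0 < d &
  forall y, `|y - x| < d ->
    exists t, B (y + const_mx t) /\ s (y + const_mx t) = r.
Proof.
move=> [Bx sx]; have [d d0 Hd] := (open_normP B).1 oB x Bx.
have e0 : 0 < d / 4 by rewrite divr_gt0.
exists (d / 4) => // y yx; set e := d / 4 in e0 yx *.
have By t : `|t| <= e -> B (y + const_mx t).
  move=> te; apply: Hd; apply: le_lt_trans (diagonal_dist (ltW yx) te) _.
  by rewrite /e; lra.
have ee : `|e| <= e by rewrite gtr0_norm.
have Nee : `|- e| <= e by rewrite normrN gtr0_norm.
have [yu yl] := dist_vll yx.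
have s1 : s (y + const_mx (- e)) < r.
  rewrite -sx; apply: s_strict => //; first exact: By.
  by move=> i; have := yu i; rewrite !mxE; lra.
have s2 : r < s (y + const_mx e).
  rewrite -sx; apply: s_strict => //; first exact: By.
  by move=> i; have := yl i; rewrite !mxE; lra.
have [|||t /[!in_itv]/= tE st] := @IVT R (fun t => s (y + const_mx t)) (- e) e r.
- by lra.
- apply: continuous_in_subspaceT => t /[!inE]/= /[!in_itv]/= tE.
  apply: (@continuous_comp _ _ _ (fun t : R => y + const_mx t) s); last first.
    by apply: sc; apply: By; rewrite ler_norml.
  apply: (@lipschitz_continuous _ _ _ _ 1) => a b; rewrite mul1r.
  by apply: normr_rV_le => // i; rewrite !mxE opprD addrACA subrr add0r.
- have s12 := lt_trans s1 s2.
  by rewrite minEle maxEle (ltW s12) !ltW.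
by exists t; split=> //; apply: By; rewrite ler_norml.
Qed.

Lemma minimal_sublevel (r : R) : 0 <= r ->
  minimal_elements (sublevel B s r%:E) (sublevel_bd B s r%:E) =
  sublevel_bd_minus B s r%:E.
Proof.
move=> r0; apply/seteqP; split=> y; rewrite /sublevel_bd/sublevel_bd_minus/=.
  move=> [[By sy] miny]; split=> //.
  have [sy0|sy0] := ltP (s y) 0; first by rewrite -sy ltr0_norm// opprK.
  move: sy; rewrite ger0_norm// => sy.
  (* For [r = 0] the levels [r] and [- r] coincide. For [0 < r] some point below [y] has a level
     between 0 and [r], against minimality. *)
  have [r_gt0|] := ltP 0 r; last by move=> r_le0; lra.
  have [z [_ [Bz _ zy _ [sz _]]]] := level_neighbours By r_gt0.
  exfalso; apply: (miny z zy); split=> //; rewrite lee_fin.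
  by have := s_strict By Bz zy; rewrite ler_norml => szy; apply/andP; split; lra.
move=> [By sy]; split; first by split=> //; rewrite sy normrN ger0_norm.
move=> z zy [Bz]; rewrite lee_fin ler_norml => /andP[sz _].
by have := s_strict By Bz zy; lra.
Qed.

Lemma maximal_sublevel (r : R) : 0 <= r ->
  maximal_elements (sublevel B s r%:E) (sublevel_bd B s r%:E) =
  sublevel_bd_plus B s r%:E.
Proof.
move=> r0; apply/seteqP; split=> y; rewrite /sublevel_bd/sublevel_bd_plus/=.
  move=> [[By sy] maxy]; split=> //.
  have [sy0|sy0] := leP 0 (s y); first by rewrite -sy ger0_norm.
  move: sy; rewrite ltr0_norm// => sy.
  have r_gt0 : 0 < r by rewrite -sy oppr_gt0.
  have [_ [w [_ Bw _ yw [_ sw]]]] := level_neighbours By r_gt0.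
  exfalso; apply: (maxy w yw); split=> //; rewrite lee_fin.
  by have := s_strict Bw By yw; rewrite ler_norml => szy; apply/andP; split; lra.
move=> [By sy]; split; first by split=> //; rewrite sy ger0_norm.
move=> z yz [Bz]; rewrite lee_fin ler_norml => /andP[_ sz].
by have := s_strict Bz By yz; lra.
Qed.

Lemma sublevel_bd_split (r : R) : 0 <= r ->
  sublevel_bd B s r%:E = sublevel_bd_minus B s r%:E `|` sublevel_bd_plus B s r%:E.
Proof.
move=> r0; apply/seteqP; split=> y /=.
  move=> [By sy]; have [sy0|sy0] := leP 0 (s y).
    by right; split=> //; rewrite -sy ger0_norm.
  by left; split=> //; rewrite -sy ltr0_norm// opprK.
by move=> [] [By ->]; split=> //; rewrite ?normrN ger0_norm.
Qed.

Lemma sublevel_pinfty : sublevel B s +oo%E = B.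
Proof. by apply/seteqP; split=> x; rewrite /sublevel/= leey => // -[]. Qed.

End LevelSets.

Theorem proposition7 (R : realType) (n : nat) (f : 'rV[R]_n -> 'rV[R]_n)
    (xs : 'rV[R]_n) (l1 : R) (v1 : 'rV[R]_n) (s1 : 'rV[R]_n -> R)
    (f_C2 : twice_continuously_differentiable f)
    (xs_stable : stable_hyperbolic f xs)
    (J_diag : diagonalizable (complex_jacobian f xs))
    (l1_dominant : dominant_eigenvalue f xs l1)
    (v1_eigen : right_eigenvector f xs l1 v1)
    (f_monotone : monotone_on f (basin f xs))
    (s1_eigen : dominant_eigenfunction f xs l1 v1 s1)
    (s1_increasing : increasing_on (basin f xs) s1) :
  let B := basin f xs in
  let Ba := sublevel B s1 in
  let bd := sublevel_bd B s1 in
  let bd_plus := sublevel_bd_plus B s1 in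
  let bd_minus := sublevel_bd_minus B s1 in
  [/\ forall alpha : \bar R, (0 <= alpha)%E ->
        order_convex (Ba alpha) /\ connected (Ba alpha),
      [/\ forall alpha : \bar R, (0 <= alpha)%E ->
            [/\ bd alpha = bd_minus alpha `|` bd_plus alpha,
                minimal_elements (Ba alpha) (bd alpha) = bd_minus alpha &
                maximal_elements (Ba alpha) (bd alpha) = bd_plus alpha],
          forall r : R, 0 < r -> bd_minus r%:E `&` bd_plus r%:E = set0,
          forall r : R, 0 <= r ->
            manifold n.-1 (bd_minus r%:E) /\ manifold n.-1 (bd_plus r%:E),
          manifold_with_edge n.-1 (bd_minus +oo%E) (bd_plus +oo%E) /\
          manifold_with_edge n.-1 (bd_plus +oo%E) (bd_minus +oo%E) &
          forall alpha : \bar R, (0 <= alpha)%E ->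
            (forall x y, bd_minus alpha x -> bd_minus alpha y -> ~ vll y x) /\
            (forall x y, bd_plus alpha x -> bd_plus alpha y -> ~ vll y x)] &
      strongly_monotone_on f B ->
        forall r : R, 0 <= r ->
          (forall x y, bd_minus r%:E x -> bd_minus r%:E y -> ~ vlt y x) /\
          (forall x y, bd_plus r%:E x -> bd_plus r%:E y -> ~ vlt y x)].
Proof.
move=> B Ba bd bd_plus bd_minus.
case: n f xs v1 s1 f_C2 xs_stable J_diag l1_dominant v1_eigen f_monotone s1_eigen
  s1_increasing @B @Ba @bd @bd_plus @bd_minus
  => [|n'] {}f {}xs {}v1 {}s1 [fC1 _] xs_stable J_diag
    l1_dom v1_eigen f_mono s1_eigen s1_inc B Ba bd bd_plus bd_minus.
  (* In dimension 0 there is no nonzero eigenvector [v1]. *)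
  by case: v1_eigen => /eqP[]; apply/rowP => -[].
have ball_B := stable_basin_ball fC1 xs_stable J_diag.
have oB : open B := basin_open fC1 ball_B.
have cB : order_convex B := basin_order_convex fC1 ball_B f_mono.
have Bxs : B xs := basin_fixed ball_B.
have l1_lt0 : l1 < 0 by exact: xs_stable.2 _ l1_dom.1.
have [sC1 _ s_flow _] := s1_eigen.
have sc x : B x -> {for x, continuous s1}.
  by move=> Bx; apply: differentiable_continuous; exact: (sC1 x Bx).1.
have s_strict x y : B x -> B y -> vll y x -> s1 y < s1 x.
  exact: (eigenfunction_strictly_increasing fC1 ball_B f_mono s1_eigen s1_inc).
(* At the fixed point the eigenfunction equation reads [s1 xs = expR l1 * s1 xs], with
   [expR l1 < 1]. *)
have sxs : s1 xs = 0.
  have flow_xs : flow f 1 xs = xs.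
    have c_sol : forward_solution f xs (cst xs).
      by split=> // t _; rewrite xs_stable.1; exact: is_derive_cst.
    by rewrite (flowE fC1 c_sol).
  have := s_flow xs 1 Bxs ler01; rewrite flow_xs mulr1 => sxs.
  have e1 : expR l1 < 1 by rewrite -expR0 ltr_expR.
  have : (1 - expR l1) * s1 xs = 0 by rewrite mulrBl mul1r -sxs subrr.
  by move/eqP; rewrite mulf_eq0 subr_eq0 gt_eqF// => /eqP.
have B_flow x t : B x -> 0 <= t -> B (flow f t x).
  by move=> Bx t0; exact: (basin_flow fC1 Bx t0).1.
have level_manifold r : manifold n' [set x | B x /\ s1 x = r].
  apply: manifold_graph => [x y Lx Ly|x Lx]; first exact: level_antichain Lx Ly.
  by have [d d0 Hd] := level_local_graph oB sc s_strict Lx; exists d.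
split; [|split|].
- move=> [r| |] // a0; last first.
    rewrite /Ba sublevel_pinfty; split=> //.
    exact: (invariant_connected (fun x Bx => Bx) Bxs B_flow).
  split.
    move=> x y [Bx] + [By] + z [xz zy].
    rewrite !lee_fin !ler_norml => /andP[x1 x2] /andP[y1 y2].
    have Bz : B z by apply: (cB x y).
    split=> //; rewrite lee_fin ler_norml.
    have h1 := s1_inc z x Bz Bx xz; have h2 := s1_inc y z By Bz zy.
    by apply/andP; split; lra.
  (* The sublevel set contains [xs], where [s1] vanishes, and is forward invariant because [|s1|]
     does not increase along the flow. *)
  apply: (@invariant_connected _ _ f xs); first by move=> x [].
    by split=> //; rewrite sxs normr0.
  move=> x t [Bx]; rewrite lee_fin => sx t0; split; first exact: B_flow.
  rewrite lee_fin s_flow// normrM ger0_norm ?expR_ge0//.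
  apply: le_trans sx; rewrite ler_piMl// -expR0 ler_expR.
  by rewrite mulr_le0_ge0// ltW.
- move=> [r| |] // a0.
    split; first exact: sublevel_bd_split.
      exact: minimal_sublevel.
    exact: maximal_sublevel.
  rewrite /Ba sublevel_pinfty; split=> //.
  exact: frontier_minimal_maximal.
- move=> r r0; apply/seteqP; split=> // x [[_ sx] [_]]; rewrite sx => srr.
  by exfalso; move: r0; lra.
- by move=> r r0; split; exact: level_manifold.
- split; first exact: minimal_manifold_with_edge.
  exact: maximal_manifold_with_edge.
- move=> [r| |] // a0; split=> x y.
  + exact: (level_antichain s_strict).
  + exact: (level_antichain s_strict).
  + exact: minimal_antichain.
  + exact: maximal_antichain.
- move=> [_ f_strong] r r0.
  (* The time-1 flow turns [vlt] into [vll] while multiplying the two equal values of [s1] by the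
     same factor, against strict increase. *)
  have level_strong c x y : B x /\ s1 x = c -> B y /\ s1 y = c -> ~ vlt y x.
    move=> [Bx sx] [By sy] yx.
    have := s_strict _ _ (B_flow _ _ Bx ler01) (B_flow _ _ By ler01)
      (f_strong _ _ By Bx yx 1 ltr01).
    by rewrite !s_flow// sx sy ltxx.
  by split=> x y; exact: level_strong.
Qed.
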